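(* For every connected graph $G$ with $n\ge 2$ vertices and rank-width at least $r$, $\Gamma_{\mathrm{CZ}}(|G\rangle)\ge n+r-2$.
   Context: Graphs are finite, simple and undirected. The Pauli group $\mathcal{G}_n$ consists of all $\alpha h_1\otimes\dots\otimes h_n$ with $\alpha\in\{\pm1,\pm i\}$, $h_j\in\{I_2,X,Y,Z\}$. The $n$-qubit Clifford group is $\mathcal{C}_n=\{U\in U(2^n): U\mathcal{G}_nU^\dagger=\mathcal{G}_n\}$. For a graph $G=(V,E)$ with $V=\{1,\dots,n\}$, the graph state $|G\rangle$ is the $n$-qubit state (unique up to global phase) that is fixed by $X_v\otimes\bigotimes_{w\in N_G(v)}Z_w$ for all $v\in V$. States are considered up to global phase. CZ-complexity: a quantum algorithm consists of (1) measurements of qubits in the computational basis (measured qubits are discarded); (2) single-qubit Clifford operations; (3) two-qubit Clifford operations (elements of $\mathcal{C}_2$ applied to any pair of qubits); later operations may depend on earlier measurement outcomes. Its CZ-complexity is the maximum, over measurement outcomes, of the number of two-qubit Clifford operations. $\Gamma_{\mathrm{CZ}}(|G\rangle)$ is the minimum CZ-complexity of an algorithm that generates $|G\rangle$ from $|0\rangle^{\otimes(n+s)}$ with probability $1$ for some $s\ge0$. Rank-width: for $S\subseteq V$, $\mathrm{cutrank}_G(S)$ is the rank over $\mathbb{F}_2$ of the $S\times(V\setminus S)$ submatrix of the adjacency matrix of $G$ (zero for $S=\varnothing$). A rank-decomposition of $G$ is a pair $(T,L)$ with $T$ a tree of maximum degree at most three with at least two vertices and $L$ a bijection from $V$ to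 the leaves of $T$. Each edge $e$ of $T$ induces a partition $\{S,V\setminus S\}$ of $V$ (via the leaves of the two components of $T-e$); the width of $e$ is $\mathrm{cutrank}_G(S)$, and the width of $(T,L)$ is the maximum width of its edges. The rank-width of $G$ is the minimum width over all rank-decompositions (and $0$ if $G$ has at most one vertex). *)

(* Defs.v *)
From HB Require Import structures.
From mathcomp Require Import all_boot all_order all_algebra.
From mathcomp Require Import ring.
From mathcomp Require Import boolp classical_sets reals.
From mathcomp Require Export complex.
Set Implicit Arguments.
Unset Strict Implicit.
Unset Printing Implicit Defensive.
Import Order.TTheory GRing.Theory Num.Theory.
Local Open Scope ring_scope.
Local Open Scope sesquilinear_scope.
Local Open Scope classical_set_scope.

(* The minimum of P, and 0 if P is empty. *)
Definition min_nat (P : set nat) : nat :=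
  match pselect (exists k, `[< P k >]) with
  | left exP => ex_minn exP
  | right _ => 0
  end.

Record sgraph (T : finType) := SGraph {
  adj :> rel T;
  adj_sym : symmetric adj;
  adj_irr : irreflexive adj }.

Section Graphs.
Variables (T : finType) (G : sgraph T).

Definition connected_graph := forall x y, connect G x y.

Definition degree x := #|[set y | G x y]%SET|.

(* ucycle also holds of the closed walks x, y, x along a single edge,
   hence the bound on the size of c. *)
Definition acyclic := forall c : seq T, ucycle G c -> (size c < 3)%N.

Definition is_tree := connected_graph /\ acyclic.

Definition del_edge (x y : T) : rel T :=
  fun u v => G u v && ((u, v) \notin [:: (x, y); (y, x)]).

Definition cutrank (S : {set T}) : nat :=
  \rank (\matrix_(i < #|S|, j < #|~: S|)
           ((G (enum_val i) (enum_val j))%:R : 'F_2)).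

End Graphs.

Section RankWidth.
Variable T : finType.

Record rank_decomposition := RankDecomposition {
  rd_node : finType;
  rd_tree : sgraph rd_node;
  rd_leaf : T -> rd_node;
  rd_card : (1 < #|rd_node|)%N;
  rd_is_tree : is_tree rd_tree;
  rd_degree : forall x, (degree rd_tree x <= 3)%N;
  rd_inj : injective rd_leaf;
  rd_leaves : forall x, (x \in codom rd_leaf) = (degree rd_tree x == 1%N) }.

Definition edge_side (D : rank_decomposition) (x y : rd_node D) : {set T} :=
  [set v | connect (del_edge (rd_tree D) x y) x (rd_leaf D v)]%SET.

Definition width (G : sgraph T) (D : rank_decomposition) : nat :=
  \max_(xy : rd_node D * rd_node D | rd_tree D xy.1 xy.2)
    cutrank G (edge_side xy.1 xy.2).

(* A graph with at most one vertex has no rank-decomposition, and gets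
   rank-width 0 from the default value of min_nat. *)
Definition rank_width (G : sgraph T) : nat :=
  min_nat [set k | exists D : rank_decomposition, width G D = k].

End RankWidth.

Section Quantum.
Variable C : numClosedFieldType.

(* The computational basis of n qubits is {ffun 'I_n -> bool}, of cardinal
   2 ^ n; vectors and operators are indexed by its enumeration. *)
Local Notation bits n := {ffun 'I_n -> bool}.
Local Notation state n := 'cV[C]_#|{ffun 'I_n -> bool}|.
Local Notation operator n := 'M[C]_#|{ffun 'I_n -> bool}|.

Definition amplitude n (psi : state n) (x : bits n) : C := psi (enum_rank x) 0.

Definition ket n (a : bits n -> C) : state n := \col_i a (enum_val i).

Definition entry n (U : operator n) (x y : bits n) : C :=
  U (enum_rank x) (enum_rank y).

Definition oper n (a : bits n -> bits n -> C) : operator n :=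
  \matrix_(i, j) a (enum_val i) (enum_val j).

Definition ket0 n : state n := ket (fun x => (x == [ffun=> false])%:R).

Definition norm2 n (psi : state n) : C := \sum_x `|amplitude psi x| ^+ 2.

Definition mx2 (a b c d : C) : 'M[C]_2 :=
  \matrix_(i, j) if i == 0 then (if j == 0 then a else b)
                 else (if j == 0 then c else d).

Definition pauliX := mx2 0 1 1 0.
Definition pauliY := mx2 0 (- 'i) 'i 0.
Definition pauliZ := mx2 1 0 0 (- 1).

Definition bit (b : bool) : 'I_2 := if b then 1 else 0.

Definition tensor n (h : 'I_n -> 'M[C]_2) : operator n :=
  oper (fun x y => \prod_j h j (bit (x j)) (bit (y j))).

Definition pauli_group n : set (operator n) :=
  [set P | exists a (h : 'I_n -> 'M[C]_2),
     [/\ a \in [:: 1; - 1; 'i; - 'i],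
         forall j, h j \in [:: 1%:M; pauliX; pauliY; pauliZ]
       & P = a *: tensor h]].

Definition clifford n : set (operator n) :=
  [set U | U \is unitarymx /\
     [set U *m P *m U ^t* | P in @pauli_group n] = @pauli_group n].

(* U acting on the qubits t_0, ..., t_(k-1) of an m-qubit register (meant for
   pairwise distinct t_i), and the identity on the other qubits. *)
Definition act_on k m (t : k.-tuple 'I_m) (U : operator k) : operator m :=
  oper (fun x y => if [forall q, (q \notin t) ==> (x q == y q)]
                   then entry U [ffun i => x (tnth t i)] [ffun i => y (tnth t i)]
                   else 0).

(* The component of psi in which qubit q is |b>, with qubit q discarded; it is
   not renormalised, so that its squared norm is the probability of the
   outcome b (when psi is a unit vector). *)
Definition collapse m (q : 'I_m.+1) (b : bool) (psi : state m.+1) : state m :=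
  ket (fun x => amplitude psi
                  [ffun j => if unlift q j is Some i then x i else b]).

(* Adaptive algorithms that start from m qubits and end with n qubits, where
   the continuation of a measurement takes its outcome as argument. *)
Inductive algorithm (n : nat) : nat -> Type :=
| Done : algorithm n n
| Measure m (q : 'I_m.+1) (next : bool -> algorithm n m) : algorithm n m.+1
| Gate1 m (q : 'I_m) (U : operator 1) (cU : @clifford 1 U)
    (next : algorithm n m) : algorithm n m
| Gate2 m (p q : 'I_m) (neq_pq : p != q) (U : operator 2)
    (cU : @clifford 2 U) (next : algorithm n m) : algorithm n m.

Fixpoint cz_complexity n m (A : algorithm n m) : nat :=
  match A with
  | Done => 0
  | Measure _ _ next =>
      maxn (cz_complexity (next false)) (cz_complexity (next true))
  | Gate1 _ _ _ _ next => cz_complexity next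
  | Gate2 _ _ _ _ _ _ next => (cz_complexity next).+1
  end.

(* The probability that A, run on psi, ends in a state satisfying good, which
   is meant to be invariant under multiplication by nonzero scalars. *)
Fixpoint success n (good : pred (state n)) m (A : algorithm n m) :
    state m -> C :=
  match A in algorithm _ m return state m -> C with
  | Done => fun psi => if good psi then norm2 psi else 0
  | Measure _ q next => fun psi =>
      success good (next false) (collapse q false psi)
      + success good (next true) (collapse q true psi)
  | Gate1 _ q U _ next => fun psi =>
      success good next (act_on [tuple q] U *m psi)
  | Gate2 _ p q _ U _ next => fun psi =>
      success good next (act_on [tuple p; q] U *m psi)
  end.

Section GraphState.
Variables (n : nat) (G : sgraph 'I_n).

Definition graph_stabilizer (v : 'I_n) : operator n :=
  tensor (fun w => if w == v then pauliX else if G v w then pauliZ else 1%:M).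

(* psi is the graph state of G up to a nonzero scalar. *)
Definition is_graph_state (psi : state n) : bool :=
  (psi != 0) && [forall v, graph_stabilizer v *m psi == psi].

Definition generates s (A : algorithm n (n + s)) : Prop :=
  success is_graph_state A (ket0 (n + s)) = 1.

Definition Gamma_CZ : nat :=
  min_nat [set k | exists s (A : algorithm n (n + s)),
                     generates A /\ cz_complexity A = k].

End GraphState.
End Quantum.

Arguments Gamma_CZ C {n} G.

(* Preparing a graph state from |0...0> with Hadamard and CZ gates: Gamma_CZ is
   the minimum of a nonempty set. *)
Module Preparation.
Section Preparation.
Variable C : numClosedFieldType.
Local Notation bits n := {ffun 'I_n -> bool}.
Local Notation state n := 'cV[C]_#|{ffun 'I_n -> bool}|.
Local Notation operator n := 'M[C]_#|{ffun 'I_n -> bool}|.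

Lemma amp_ket n (a : bits n -> C) x : amplitude (ket a) x = a x.
Proof. by rewrite /amplitude mxE enum_rankK. Qed.

Lemma ent_oper n (a : bits n -> bits n -> C) x y : entry (oper a) x y = a x y.
Proof. by rewrite /entry mxE !enum_rankK. Qed.

Lemma sum_rank n (F : 'I_#|{ffun 'I_n -> bool}| -> C) :
  \sum_i F i = \sum_(x : bits n) F (enum_rank x).
Proof.
by rewrite (reindex enum_rank) //; exists enum_val => i _; rewrite ?enum_valK ?enum_rankK.
Qed.

Lemma amp_mul n (U : operator n) psi x :
  amplitude (U *m psi) x = \sum_y entry U x y * amplitude psi y.
Proof. by rewrite /amplitude mxE sum_rank. Qed.

Lemma amp_ext n (u v : state n) : (forall x, amplitude u x = amplitude v x) -> u = v.
Proof. move=> h; apply/matrixP => i j; rewrite ord1 -(enum_valK i); exact: h. Qed.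

Lemma ent_mul n (U V : operator n) x z :
  entry (U *m V) x z = \sum_y entry U x y * entry V y z.
Proof. by rewrite /entry mxE sum_rank. Qed.

Lemma ent_ext n (u v : operator n) : (forall x y, entry u x y = entry v x y) -> u = v.
Proof. move=> h; apply/matrixP => i j; rewrite -(enum_valK i) -(enum_valK j); exact: h. Qed.

Lemma ent_1 n (x y : bits n) : entry (1%:M : operator n) x y = (x == y)%:R.
Proof. by rewrite /entry mxE (inj_eq enum_rank_inj). Qed.

Lemma invol_clifford n (U : operator n) : U ^t* = U -> U *m U = 1%:M ->
  (forall P, pauli_group P -> pauli_group (U *m P *m U)) -> clifford U.
Proof.
move=> Ua UU UP; split; first by apply/unitarymxP; rewrite Ua.
rewrite Ua; apply/seteqP; split => P /=.
  by move=> [Q QP <-]; apply: UP.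
move=> PP; exists (U *m P *m U); first exact: UP.
by rewrite !mulmxA UU mul1mx -mulmxA UU mulmx1.
Qed.

Definition b1 (b : bool) : bits 1 := [ffun=> b].

Lemma b1P (x : bits 1) : x = b1 (x ord0).
Proof. by apply/ffunP => i; rewrite ffunE ord1. Qed.

Lemma b1_eq b b' : (b1 b == b1 b') = (b == b').
Proof. by apply/eqP/eqP => [/ffunP/(_ ord0)|->//]; rewrite !ffunE. Qed.

Lemma sum1 (F : bits 1 -> C) : \sum_x F x = F (b1 true) + F (b1 false).
Proof.
rewrite (reindex b1); last first.
  by exists (fun x : bits 1 => x ord0) => [b _|x _]; [rewrite ffunE | rewrite -b1P].
by rewrite big_bool.
Qed.

Definition c : C := (sqrtC 2%:R)^-1.

Lemma cc : c * c = 2%:R^-1.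
Proof. by rewrite /c -invfM -expr2 sqrtCK. Qed.

Definition Hd : operator 1 := oper (fun x y => c * (-1) ^+ (x ord0 && y ord0)).

Lemma c_real : c^* = c.
Proof. by apply/CrealP/ger0_real; rewrite invr_ge0 sqrtC_ge0 ler0n. Qed.

Lemma Hd_cl : clifford Hd.
Proof.
have two : (2%:R : C) != 0 by rewrite pnatr_eq0.
apply: invol_clifford.
- apply: ent_ext => x y; rewrite {1}/entry !mxE !enum_rankK ent_oper.
  rewrite rmorphM rmorphXn rmorphN1 /=. rewrite [X in X * _]c_real andbC //.
- apply: ent_ext => x y; rewrite ent_mul ent_1 sum1 !ent_oper (b1P x) (b1P y) !ffunE.
  rewrite ![c * _ * (c * _)]mulrACA cc b1_eq.
  by case: (x ord0) (y ord0) => -[] /=; rewrite ?expr0 ?expr1; field.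
move=> _ [a [h [ha hh ->]]].
have /[!inE] h0 := hh ord0.
have key b k : b \in [:: 1; - 1; 'i; - 'i] ->
   k \in [:: 1%:M; pauliX C; pauliY C; pauliZ C] ->
   Hd *m tensor h *m Hd = b *: tensor (fun _ : 'I_1 => k) ->
   pauli_group (Hd *m (a *: tensor h) *m Hd).
  move=> bb kk e; exists (a * b), (fun _ => k); split => //; last first.
    by rewrite -scalemxAr -scalemxAl e scalerA.
  move: ha bb; rewrite !inE => /or4P[] /eqP -> /or4P[] /eqP ->;
  rewrite ?mulrN ?mulNr ?mul1r ?mulr1 ?opprK -?expr2 ?sqrCi ?opprK ?eqxx ?orbT //.
have calc (b : C) (k : 'M[C]_2) : (forall x y : bool,
    2%:R^-1 * (h ord0 (bit true) (bit true) * (-1) ^+ (x && true) * (-1) ^+ (true && y)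
   + h ord0 (bit false) (bit true) * (-1) ^+ (x && false) * (-1) ^+ (true && y)
   + (h ord0 (bit true) (bit false) * (-1) ^+ (x && true) * (-1) ^+ (false && y)
   + h ord0 (bit false) (bit false) * (-1) ^+ (x && false) * (-1) ^+ (false && y)))
    = b * k (bit x) (bit y)) ->
   Hd *m tensor h *m Hd = b *: tensor (fun _ : 'I_1 => k).
  move=> e; apply: ent_ext => x y; rewrite ent_mul sum1 !ent_mul !sum1 !ent_oper.
  rewrite [in RHS]/entry mxE -/(entry _ _ _) !ent_oper !big_ord1 -e -cc !ffunE.
  by ring.
case/or4P: h0 => /eqP e0.
- apply: (key 1 1%:M); rewrite ?inE ?eqxx //; apply: calc.
  by rewrite e0 => -[] [] /=; rewrite !mxE /= ?expr0 ?expr1; field.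
- apply: (key 1 (pauliZ C)); rewrite ?inE ?eqxx ?orbT //; apply: calc.
  by rewrite e0 => -[] [] /=; rewrite !mxE /= ?expr0 ?expr1; field.
- apply: (key (-1) (pauliY C)); rewrite ?inE ?eqxx ?orbT //; apply: calc.
  by rewrite e0 => -[] [] /=; rewrite !mxE /= ?expr0 ?expr1; field.
- apply: (key 1 (pauliX C)); rewrite ?inE ?eqxx ?orbT //; apply: calc.
  by rewrite e0 => -[] [] /=; rewrite !mxE /= ?expr0 ?expr1; field.
Qed.

Definition CZ : operator 2 :=
  oper (fun x y => (x == y)%:R * (-1) ^+ (x ord0 && x ord_max)).

Lemma CZl U x y : entry (CZ *m U) x y = (-1) ^+ (x ord0 && x ord_max) * entry U x y.
Proof.
rewrite ent_mul (bigD1 x) //= big1 ?addr0 ?ent_oper ?eqxx ?mul1r // => z zx.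
by rewrite ent_oper eq_sym (negPf zx) !mul0r.
Qed.

Lemma CZr U x y : entry (U *m CZ) x y = (-1) ^+ (y ord0 && y ord_max) * entry U x y.
Proof.
rewrite ent_mul (bigD1 y) //= big1 ?addr0 ?ent_oper ?eqxx ?mul1r 1?mulrC // => z zx.
by rewrite ent_oper (negPf zx) mul0r mulr0.
Qed.

Ltac solve_cz e0 e1 key b k0 k1 E1 EX EY EZ :=
 solve [apply: (key b k0 k1); rewrite ?inE ?eqxx ?orbT //;
   rewrite e0 e1 => -[] [] [] [];
   rewrite ?E1 ?EX ?EY ?EZ /= ?expr0 ?expr1;
   rewrite ?(mulr0, mul0r, mul1r, mulr1, mulrN, mulNr, opprK, oppr0)
     -?expr2 ?sqrCi ?(opprK, oppr0) //].

Lemma CZ_cl : clifford CZ.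
Proof.
apply: invol_clifford.
- apply: ent_ext => x y; rewrite {1}/entry !mxE !enum_rankK ent_oper.
  rewrite rmorphM rmorphXn rmorphN1 rmorph_nat eq_sym.
  by case: eqP => [->|] //; rewrite !mul0r.
- apply: ent_ext => x y; rewrite CZl ent_1 ent_oper; case: eqP => [->|]; last by rewrite mul0r mulr0.
  by rewrite !mul1r -expr2 sqrr_sign.
move=> _ [a [h [ha hh ->]]].
have h0 := hh ord0; have h1 := hh ord_max.
have key b k0 k1 : b \in [:: 1; - 1; 'i; - 'i] ->
   k0 \in [:: 1%:M; pauliX C; pauliY C; pauliZ C] ->
   k1 \in [:: 1%:M; pauliX C; pauliY C; pauliZ C] ->
   (forall x0 x1 y0 y1 : bool, 
     (-1) ^+ (x0 && x1) * (-1) ^+ (y0 && y1) *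
     (h ord0 (bit x0) (bit y0) * h ord_max (bit x1) (bit y1))
     = b * (k0 (bit x0) (bit y0) * k1 (bit x1) (bit y1))) ->
   pauli_group (CZ *m (a *: tensor h) *m CZ).
  move=> bb kk0 kk1 e; exists (a * b), (fun i => if i == ord0 then k0 else k1); split => //.
  - move: ha bb; rewrite !inE => /or4P[] /eqP -> /or4P[] /eqP ->;
    rewrite ?mulrN ?mulNr ?mul1r ?mulr1 ?opprK -?expr2 ?sqrCi ?opprK ?eqxx ?orbT //.
  - by move=> j; case: ifP.
  rewrite -scalemxAr -scalemxAl -scalerA; congr (_ *: _).
  apply: ent_ext => x y; rewrite CZr CZl ent_oper [in RHS]/entry mxE -/(entry _ _ _) ent_oper.
  rewrite !big_ord_recl !big_ord0 !mulr1 /=.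
  rewrite (_ : lift ord0 ord0 = ord_max); last exact: val_inj.
  by rewrite -e mulrCA mulrA.
have R1 (M : 'M[C]_2) b c d e : M = mx2 b c d e ->
   (M (bit false) (bit false) = b) * (M (bit false) (bit true) = c) *
   (M (bit true) (bit false) = d) * (M (bit true) (bit true) = e).
  by move=> ->; rewrite !mxE.
have I2 : 1%:M = mx2 1 0 0 1 :> 'M[C]_2.
  by apply/matrixP => -[[|[|]] //= ?] [[|[|]] //= ?]; rewrite !mxE.
have E1 := R1 _ _ _ _ _ I2. have EX := R1 (pauliX C) _ _ _ _ erefl.
have EY := R1 (pauliY C) _ _ _ _ erefl. have EZ := R1 (pauliZ C) _ _ _ _ erefl.
move: h0 h1; rewrite !inE => /or4P[] /eqP e0 /or4P[] /eqP e1.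
- solve_cz e0 e1 key (1:C) (1%:M : 'M[C]_2) (1%:M : 'M[C]_2) E1 EX EY EZ.
- solve_cz e0 e1 key (1:C) (pauliZ C) (pauliX C) E1 EX EY EZ.
- solve_cz e0 e1 key (1:C) (pauliZ C) (pauliY C) E1 EX EY EZ.
- solve_cz e0 e1 key (1:C) (1%:M : 'M[C]_2) (pauliZ C) E1 EX EY EZ.
- solve_cz e0 e1 key (1:C) (pauliX C) (pauliZ C) E1 EX EY EZ.
- solve_cz e0 e1 key (1:C) (pauliY C) (pauliY C) E1 EX EY EZ.
- solve_cz e0 e1 key (- 1 : C) (pauliY C) (pauliX C) E1 EX EY EZ.
- solve_cz e0 e1 key (1:C) (pauliX C) (1%:M : 'M[C]_2) E1 EX EY EZ.
- solve_cz e0 e1 key (1:C) (pauliY C) (pauliZ C) E1 EX EY EZ.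
- solve_cz e0 e1 key (- 1 : C) (pauliX C) (pauliY C) E1 EX EY EZ.
- solve_cz e0 e1 key (1:C) (pauliX C) (pauliX C) E1 EX EY EZ.
- solve_cz e0 e1 key (1:C) (pauliY C) (1%:M : 'M[C]_2) E1 EX EY EZ.
- solve_cz e0 e1 key (1:C) (pauliZ C) (1%:M : 'M[C]_2) E1 EX EY EZ.
- solve_cz e0 e1 key (1:C) (1%:M : 'M[C]_2) (pauliX C) E1 EX EY EZ.
- solve_cz e0 e1 key (1:C) (1%:M : 'M[C]_2) (pauliY C) E1 EX EY EZ.
- solve_cz e0 e1 key (1:C) (pauliZ C) (pauliZ C) E1 EX EY EZ.
Qed.

Definition upd n (x : bits n) q b : bits n := [ffun j => if j == q then b else x j].

Lemma amp_H n (q : 'I_n) psi x :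
  amplitude (act_on [tuple q] Hd *m psi) x =
  c * ((-1) ^+ (x q) * amplitude psi (upd x q true) + amplitude psi (upd x q false)).
Proof.
rewrite amp_mul.
under eq_bigr do rewrite ent_oper.
rewrite (bigD1 (upd x q true)) //= (bigD1 (upd x q false)) /=; last first.
  by apply/eqP => /ffunP /(_ q); rewrite !ffunE eqxx.
rewrite big1 ?addr0; last first.
  move=> y /andP[y1 y2]; case: ifP => [/forallP h|]; last by rewrite mul0r.
  have e b : y q = b -> y = upd x q b.
    move=> yq; apply/ffunP => j; rewrite ffunE; case: eqP => [->//|/eqP jq].
    by have := h j; rewrite inE jq /= => /eqP.
  by case yq: (y q); move: (e _ yq) y1 y2 => ->; rewrite eqxx.
rewrite !ifT; last 2 first.
- by apply/forallP => j; apply/implyP; rewrite inE ffunE => /negPf ->.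
- by apply/forallP => j; apply/implyP; rewrite inE ffunE => /negPf ->.
rewrite !ent_oper !ffunE /= (tnth_nth q) /= eqxx andbT andbF expr0 mulr1.
by rewrite mulrDr mulrA.
Qed.

Lemma amp_CZ n (p q : 'I_n) psi x :
  amplitude (act_on [tuple p; q] CZ *m psi) x = (-1) ^+ (x p && x q) * amplitude psi x.
Proof.
rewrite amp_mul.
under eq_bigr do rewrite ent_oper.
rewrite (bigD1 x) //= big1 ?addr0; last first.
  move=> y yx; case: ifP => [/forallP h|]; last by rewrite mul0r.
  rewrite ent_oper; case: eqP => [e|]; last by rewrite !mul0r.
  case/eqP: yx; apply/ffunP => j; have := h j; rewrite !inE negb_or.
  case: eqVneq => [-> _|jp].
    by move/ffunP/(_ ord0): e; rewrite !ffunE !(tnth_nth p).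
  case: eqVneq => [-> _|jq /= /eqP //].
  by move/ffunP/(_ ord_max): e; rewrite !ffunE !(tnth_nth p).
  rewrite ifT; last by apply/forallP => j; apply/implyP => _; exact: eqxx.
by rewrite ent_oper eqxx mul1r !ffunE !(tnth_nth p).
Qed.

Lemma H_alg n good m (A : algorithm C n m) l : exists A' : algorithm C n m,
  forall psi, success good A' psi =
   success good A (foldr (fun q psi => act_on [tuple q] Hd *m psi) psi l).
Proof.
elim: l A => [|q l IH] A; first by exists A.
by have [A' h] := IH (Gate1 q Hd_cl A); exists A'.
Qed.

Lemma CZ_alg n good m (A : algorithm C n m) (l : seq ('I_m * 'I_m)) :
  all (fun pq => pq.1 != pq.2) l -> exists A' : algorithm C n m,
  forall psi, success good A' psi =
   success good A (foldr (fun pq psi => act_on [tuple pq.1; pq.2] CZ *m psi) psi l).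
Proof.
elim: l A => [|pq l IH] A /=; first by exists A.
move=> /andP[ne /IH{}IH].
by have [A' h] := IH (Gate2 ne CZ_cl A); exists A'.
Qed.

Lemma amp_Hs n (l : seq 'I_n) x : uniq l ->
  amplitude (foldr (fun q psi => act_on [tuple q] Hd *m psi) (ket0 C n) l) x
  = c ^+ size l * ([forall q, (q \notin l) ==> ~~ x q])%:R.
Proof.
elim: l x => [|q l IH] x /=.
  rewrite amp_ket expr0 mul1r => _; apply: (congr1 (fun b : bool => (b%:R : C))).
  apply/eqP/forallP => [-> q|h].
    by rewrite ffunE.
  by apply/ffunP => q; rewrite ffunE; apply/negbTE/h.
move=> /andP[ql ul]; rewrite amp_H !IH //.
have -> : [forall q0, (q0 \notin l) ==> ~~ upd x q true q0] = false.
  by apply/forallP => /(_ q); rewrite ql ffunE eqxx.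
rewrite mulr0 mulr0 add0r mulrA -exprS; congr (_ * (nat_of_bool _)%:R).
apply: eq_forallb => j; rewrite inE ffunE negb_or.
by case: eqVneq => [->|] //=; rewrite ql.
Qed.

Lemma amp_CZs n (l : seq ('I_n * 'I_n)) psi x :
  amplitude (foldr (fun pq psi => act_on [tuple pq.1; pq.2] CZ *m psi) psi l) x
  = \prod_(pq <- l) (-1) ^+ (x pq.1 && x pq.2) * amplitude psi x.
Proof.
elim: l => [|q l IH] /=; first by rewrite big_nil mul1r.
by rewrite amp_CZ IH big_cons mulrA.
Qed.

Lemma tensor_amp n (G : sgraph 'I_n) v psi x :
  amplitude (graph_stabilizer C G v *m psi) x =
   \prod_(w | G v w) (-1) ^+ x w * amplitude psi (upd x v (~~ x v)).
Proof.
rewrite amp_mul (bigD1 (upd x v (~~ x v))) //= big1 ?addr0; last first.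
  move=> y yx; rewrite ent_oper.
  have [w] : exists w, y w != upd x v (~~ x v) w.
    apply/existsP; rewrite -negb_forall; apply: contra yx => /forallP h.
    by apply/eqP/ffunP => w; apply/eqP.
  rewrite ffunE (bigD1 w) //=; case: (eqVneq w v) => [->|_] h /=.
    suff -> : pauliX C (bit (x v)) (bit (y v)) = 0 by rewrite !mul0r.
    by rewrite mxE; case: (x v) (y v) h => -[].
  case: ifP => _.
    suff -> : pauliZ C (bit (x w)) (bit (y w)) = 0 by rewrite !mul0r.
    by rewrite mxE; case: (x w) (y w) h => -[].
  suff -> : (1%:M : 'M[C]_2) (bit (x w)) (bit (y w)) = 0 by rewrite !mul0r.
  by rewrite mxE; case: (x w) (y w) h => -[].
congr (_ * _); rewrite ent_oper [RHS]big_mkcond; apply: eq_bigr => w _.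
rewrite ffunE; case: eqP => [->|_].
  by rewrite adj_irr mxE; case: (x v).
by case: ifP => _; rewrite mxE; case: (x w); rewrite ?expr0 ?expr1.
Qed.

Lemma exists_algorithm n (G : sgraph 'I_n) :
  exists s (A : algorithm C n (n + s)), generates G A.
Proof.
exists 0%N; rewrite /generates.
suff: forall m, m = n -> exists A : algorithm C n m,
  success (is_graph_state G) A (ket0 C m) = 1.
  by apply; rewrite addn0.
move=> _ ->.
pose l := [seq pq : 'I_n * 'I_n <- index_enum _ | (pq.1 < pq.2)%N && G pq.1 pq.2].
have hl : all (fun pq => pq.1 != pq.2) l.
  apply/allP => -[p q]; rewrite mem_filter /= => /andP[/andP[pq _] _].
  by rewrite -val_eqE neq_ltn pq.
have [A1 hA1] := CZ_alg (is_graph_state G) (Done C n) hl.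
have [A2 hA2] := H_alg (is_graph_state G) A1 (index_enum 'I_n).
exists A2; rewrite hA2 hA1 /=.
set psi := foldr _ _ _.
have psiE x : amplitude psi x =
  \prod_(pq : 'I_n * 'I_n | (pq.1 < pq.2)%N && G pq.1 pq.2)
    (-1) ^+ (x pq.1 && x pq.2) * c ^+ n.
  rewrite amp_CZs big_filter; congr (_ * _).
  rewrite amp_Hs ?index_enum_uniq // (_ : [forall _, _] = true) ?mulr1.
    by rewrite -[in RHS](card_ord n) cardE enumT.
  by apply/forallP => q; rewrite mem_index_enum.
have cn2 : c ^+ n * c ^+ n = (2 ^ n)%:R^-1.
  by rewrite -exprMn cc exprVn natrX.
have norm1 x : `|amplitude psi x| ^+ 2 = (2 ^ n)%:R^-1.
  rewrite psiE normrM normr_prod big1 ?mul1r; last first.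
    by move=> *; rewrite normrX normrN1 expr1n.
  rewrite ger0_norm ?expr2 ?cn2 // exprn_ge0 // invr_ge0 sqrtC_ge0 ler0n //.
have p2 : (2 ^ n)%:R != 0 :> C by rewrite pnatr_eq0 expn_eq0.
have n1 : norm2 psi = 1.
  rewrite /norm2; under eq_bigr do rewrite norm1.
  by rewrite sumr_const card_ffun card_bool card_ord -[_ *+ _]mulr_natl divff.
rewrite ifT //; apply/andP; split.
  apply/eqP => p0; move: (norm1 [ffun=> false]); rewrite p0 /amplitude mxE normr0 expr0n /=.
  by move/esym/eqP; rewrite invr_eq0 (negPf p2).
apply/forallP => v; apply/eqP/amp_ext => x.
rewrite tensor_amp !psiE mulrA; congr (_ * _).
pose E (p q : 'I_n) := (p < q)%N && G p q.
have -> : \prod_(w | G v w) (-1) ^+ x w =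
  (\prod_(pq : 'I_n * 'I_n | E pq.1 pq.2) (if pq.1 == v then (-1) ^+ x pq.2 else 1)) *
  (\prod_(pq : 'I_n * 'I_n | E pq.1 pq.2) (if pq.2 == v then (-1) ^+ x pq.1 else 1)) :> C.
  rewrite -(pair_big_dep predT E (fun p q => if p == v then (-1) ^+ x q else 1)) /=.
  rewrite -(pair_big_dep predT E (fun p q => if q == v then (-1) ^+ x p else 1)) /=.
  rewrite [X in _ = X * _](bigD1 v) //= [X in _ = _ * X * _]big1 ?mulr1; last first.
    by move=> i /negPf ->; rewrite big1.
  rewrite [X in _ = _ * X](eq_bigr (fun i => if E i v then (-1) ^+ x i else 1)); last first.
    move=> i _; case: ifP => Ei.
      rewrite (bigD1 v) //= eqxx big1 ?mulr1 // => j /andP[_ /negPf ->] //.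
    by rewrite big1 // => j Eij; case: eqP => // jv; rewrite jv Ei in Eij.
  rewrite eqxx big_mkcond [X in _ = X * _]big_mkcond -big_split; apply: eq_bigr => w _.
  rewrite /E (adj_sym G w v); case Gvw: (G v w); rewrite ?andbF ?andbT /= ?mulr1 //.
  have: w != v by apply: contraTneq Gvw => ->; rewrite adj_irr.
  by rewrite -val_eqE neq_ltn /=; case: ltngtP => //; rewrite ?mulr1 ?mul1r.
rewrite -!big_split; apply: eq_bigr => -[p q] /= /andP[pq _].
have: p != q by rewrite -val_eqE neq_ltn pq.
rewrite !ffunE; case: (eqVneq p v) => [->|pv]; case: (eqVneq q v) => [->|qv] //=.
- by move=> _; rewrite mulr1; case: (x v); case: (x q); rewrite /= ?expr0 ?expr1; ring.
- by move=> _; rewrite mul1r; case: (x v); case: (x p); rewrite /= ?expr0 ?expr1; ring.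
by rewrite !mul1r.
Qed.

End Preparation.
End Preparation.

(* Main.v *)
Require Import Defs.
From mathcomp Require Import all_boot all_order all_fingroup all_algebra reals complex.
From mathcomp Require Import boolp zify ring.

(* Follow one branch of the algorithm that has nonzero probability.  Along it the
   state stays a tensor product over groups of qubits, and each group K carries
   a binary tree with leaf set K all of whose cuts have Schmidt rank at most
   2^w.  A two-qubit Clifford gate is, possibly after exchanging its outputs, a
   sum of two product operators.  Inside a group it therefore raises w by at
   most one; between two groups it merges them, joining their trees by an edge
   of Schmidt rank 2, and the new w is the maximum of the old ones.  Measurements
   only delete leaves.  Hence |K| + w <= g + 2, where g counts the gates spent on
   K.  The graph state of a connected graph is not a product, so the final state
   is a single group with n qubits, and its tree is a rank-decomposition of width
   at most w, because the Schmidt rank of a graph state across a cut is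
   2^cutrank. *)

(** The exchange of outputs cannot be avoided: SWAP has operator Schmidt rank 4, so a Clifford gate
    may multiply the Schmidt rank of a cut by four. But an exchange of two qubits only relabels
    leaves, and up to it the operator Schmidt rank is at most 2. The constant 2 comes from a single
    qubit, where |K| = w = 1 and g = 0. Here w is 1 and not 0 because the pendant edge at a leaf
    needs Schmidt rank 2 as soon as the qubit is entangled with others. Keeping w >= 1 also pays for
    merging: max(w1, w2) <= w1 + w2 - 1, so two bounds with constants 2 + 2 combine, at the price of
    one gate, into a bound with constant 2 again. Only nonvanishing and ranks matter, so states are
    handled as unnormalised functions on bit strings. *)

Set Implicit Arguments.
Unset Strict Implicit.
Unset Printing Implicit Defensive.

(** * Binary decompositions and rank-decompositions *)

Section Decomposition.
Variable T : finType.
Implicit Types (A B K S : {set T}) (P Q : {set T} -> Prop).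

(* dec P S: S is the leaf set of a binary tree each of whose nodes has a leaf set
   satisfying P. *)
Inductive dec P : {set T} -> Prop :=
| Dec1 x : P [set x] -> dec P [set x]
| DecU A B : [disjoint A & B] -> dec P A -> dec P B -> P (A :|: B) ->
    dec P (A :|: B).

Lemma dec_P P S : dec P S -> P S.
Proof. by case. Qed.

Lemma dec_sub P Q S :
  (forall A, A \subset S -> P A -> Q A) -> dec P S -> dec Q S.
Proof.
move=> PQ dS; elim: {S} dS PQ => [x Px|A B dAB _ IA _ IB PAB] PQ.
  by apply: Dec1; apply: PQ.
apply: DecU => //; last exact: PQ.
- by apply: IA => S SA; apply: PQ; rewrite (subset_trans SA) ?subsetUl.
- by apply: IB => S SB; apply: PQ; rewrite (subset_trans SB) ?subsetUr.
Qed.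

(** The leaf [p] is replaced by a tree on [p |: K']. The only leaf sets that change are those
    containing [p], and each of them gains exactly [K']; the induction descends into the child that
    contains [p]. *)
Lemma dec_graft P Q K K' p :
  (forall S, S \subset K -> p \notin S -> P S -> Q S) ->
  (forall S, S \subset K -> p \in S -> P S -> Q (S :|: K')) ->
  [disjoint K & K'] -> dec Q (p |: K') -> dec P K -> p \in K ->
  dec Q (K :|: K').
Proof.
move=> PQ PQ' dK dp dPK; elim: {K} dPK PQ PQ' dK.
  move=> x _ PQ PQ' dK; by rewrite inE => /eqP <-.
move=> A B dAB dA IA dB IB PAB PQ PQ' dK.
have sA : A \subset A :|: B by apply: subsetUl.
have sB : B \subset A :|: B by apply: subsetUr.
wlog pA : A B dAB dA IA dB IB PAB PQ PQ' dK sA sB / p \in A => [W|] pAB.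
  case/setUP: (pAB) => [pA|pB]; first exact: (W A B).
  by rewrite setUC in PQ PQ' pAB PAB dK *; apply: (W B A) => //;
    rewrite ?[B :|: A]setUC // disjoint_sym.
rewrite setUAC; apply: DecU => //.
- rewrite -setI_eq0 setIUl setU_eq0 setI_eq0 dAB setIC setI_eq0.
  exact: disjointWl dK.
- apply: IA => //; last exact: disjointWl dK.
  + by move=> S SA; apply: PQ; apply: subset_trans SA sA.
  + by move=> S SA; apply: PQ'; apply: subset_trans SA sA.
- apply: dec_sub dB => S SB; apply: PQ; first exact: subset_trans SB sB.
  apply: contraL pA => /(subsetP SB) pB.
  by rewrite (disjointFl dAB pB).
- by rewrite setUAC; apply: PQ'.
Qed.

(** Reversing the path from the root to [q] turns the leaf set [S] of each node on it into
    [K :\: S], hence the closure of [P] under complement in [K]. The descent maintains a tree on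
    [K :\: S], which at the leaf [q] is the tree sought. *)
Lemma dec_reroot P K q : (forall S, S \subset K -> P S -> P (K :\: S)) ->
  dec P K -> q \in K -> K != [set q] -> dec P (K :\ q).
Proof.
move=> PC dK qK Kq.
(* The first disjunct is the case of the root, above which nothing remains. *)
suff: forall S, dec P S -> S \subset K -> q \in S ->
    K :\: S = set0 \/ dec P (K :\: S) -> dec P (K :\ q).
  by move/(_ K dK); apply=> //; left; rewrite setDv.
move=> S; elim=> {S} [x _|A B dAB dA IA dB IB PAB] SK.
  rewrite inE => /eqP qx; subst x; case=> // K0.
  case/negP: Kq; rewrite eqEsubset -setD_eq0 K0 eqxx /=.
  by rewrite sub1set.
have sA : A \subset A :|: B by apply: subsetUl.
have sB : B \subset A :|: B by apply: subsetUr.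
wlog qA : A B dAB dA IA dB IB PAB SK sA sB / q \in A => [W|] qAB dS.
  case/setUP: (qAB) => [qA|qB]; first exact: (W A B).
  by rewrite setUC in SK qAB PAB dS; apply: (W B A) => //;
    rewrite ?[B :|: A]setUC // disjoint_sym.
have AK : A \subset K := subset_trans sA SK.
apply: IA => //; right.
(* In the reversed tree the children of this node are the sibling [B] and what lies above the
   parent. *)
have E : K :\: A = B :|: (K :\: (A :|: B)).
  apply/setP => v; rewrite !inE.
  have [vA|vA] := boolP (v \in A); first by rewrite (disjointFr dAB vA).
  have [vB|//] := boolP (v \in B); rewrite (subsetP SK) //; exact: (subsetP sB).
case: dS => [E0|dS]; first by rewrite E E0 setU0.
rewrite E; apply: DecU => //; last by rewrite -E; apply: PC => //; apply: dec_P dA.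
rewrite -setI_eq0; apply/eqP/setP => v; rewrite !inE.
by case: (v \in B) => //; rewrite orbT.
Qed.

End Decomposition.

(** Leaves outside the image of [h] are deleted. A node that loses all leaves under one child is
    suppressed in favour of the other child. *)
Lemma dec_preim (T T' : finType) (h : T' -> T) (P : {set T} -> Prop)
    (Q : {set T'} -> Prop) (K : {set T}) : injective h ->
  (forall S : {set T}, S \subset K -> P S -> Q (h @^-1: S)) ->
  dec P K -> h @^-1: K != set0 -> dec Q (h @^-1: K).
Proof.
move=> hi PQ dK; elim: {K} dK PQ => [x Px|A B dAB dA IA dB IB PAB] PQ.
  case/set0Pn=> y; rewrite !inE => /eqP hy.
  have E : h @^-1: [set x] = [set y].
    by apply/setP => z; rewrite !inE -hy (inj_eq hi).
  by rewrite E; apply: Dec1; rewrite -E; apply: PQ.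
rewrite preimsetU => AB0.
have {}IA := IA (fun (S : {set T}) SA => PQ S (subset_trans SA (subsetUl A B))).
have {}IB := IB (fun (S : {set T}) SB => PQ S (subset_trans SB (subsetUr A B))).
have [A0|A0] := eqVneq (h @^-1: A) set0.
  by move: AB0; rewrite A0 set0U => /IB.
have [B0|B0] := eqVneq (h @^-1: B) set0.
  by move: AB0; rewrite B0 setU0 => /IA.
apply: DecU; [|exact: IA|exact: IB|by rewrite -preimsetU; apply: PQ].
rewrite -setI_eq0 -preimsetI; move: dAB; rewrite -setI_eq0 => /eqP ->.
by rewrite preimset0.
Qed.

(** * Rooted binary trees given by parent pointers *)

Record rooted (T : finType) := Rooted {
  node :> finType;
  par : node -> node;
  root : node;
  depth : node -> nat;
  leaf : T -> node }.

Definition kids T (t : rooted T) (x : t) : {set t} :=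
  [set y | (y != root t) && (par y == x)].

Definition below T (t : rooted T) (x y : t) := fconnect (@par T t) y x.

(** [depth] need not be the distance to the root: its strict decrease along [par] is what excludes
    cycles of parent pointers. Values of [leaf] outside [S] are arbitrary. *)
Definition binary_on T (t : rooted T) (S : {set T}) :=
  [/\ par (root t) = root t,
      forall x : t, x != root t -> depth (par x) < depth x,
      forall x : t, #|kids x| = if x \in (@leaf T t) @: S then 0 else 2
    & {in S &, injective (@leaf T t)}].

Definition join T (t1 t2 : rooted T) (A : {set T}) : rooted T :=
  @Rooted T (option (t1 + t2)%type)
    (fun x => match x with
              | None => None
              | Some (inl y) => if y == root t1 then None else Some (inl (par y))
              | Some (inr y) => if y == root t2 then None else Some (inr (par y))
              end)
    None
    (fun x => match x with
              | None => 0
              | Some (inl y) => (depth y).+1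
              | Some (inr y) => (depth y).+1
              end)
    (fun v => Some (if v \in A then inl (leaf t1 v) else inr (leaf t2 v))).

Lemma belowP T (t : rooted T) (x y : t) :
  reflect (exists i, iter i (@par T t) y = x) (below x y).
Proof.
apply: (iffP idP) => [h|[i <-]]; last exact: fconnect_iter.
by exists (findex (@par T t) y x); apply: iter_findex.
Qed.

Section Join.
Variables (T : finType) (t1 t2 : rooted T) (A B : {set T}).
Hypothesis dAB : [disjoint A & B].
Hypothesis bin1 : binary_on t1 A.
Hypothesis bin2 : binary_on t2 B.
Let t := join t1 t2 A.

Lemma below_joinN (y : t) : below (None : t) y.
Proof.
apply/belowP; exists (depth y).
have [_ d1 _ _] := bin1; have [_ d2 _ _] := bin2.
have iN i : iter i (@par T t) None = None by elim: i => //= i ->.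
suff h : forall k (z : t), depth z <= k -> iter k (@par T t) z = None.
  exact: h (leqnn _).
elim=> [|k IH] [[z|z]|] //; rewrite ?iN // => dz; rewrite iterSr; apply: IH => /=.
  by case: eqP => // /eqP zr; rewrite (leq_trans (d1 z zr)).
by case: eqP => // /eqP zr; rewrite /= (leq_trans (d2 z zr)).
Qed.

(** The numbers of steps may differ: the root of [t1] is a fixed point of [par] in [t1], but moves
    on to [None] in the join, so steps spent idling at the root have to be dropped. *)
Lemma below_join_l (x y : t1) :
  below (Some (inl x) : t) (Some (inl y) : t) = below x y.
Proof.
have [r1 _ _ _] := bin1.
have iN i : iter i (@par T t) None = None by elim: i => //= i ->.
have ir i : iter i (@par T t1) (root t1) = root t1 by elim: i => //= i ->.
apply/belowP/belowP; case=> i; elim: i y => [|i IH] y.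
- by case=> ->; exists 0.
- rewrite iterSr /=; case: eqP => [_|_ /IH [j <-]]; first by rewrite iN.
  by exists j.+1; rewrite iterSr.
- by move=> /= ->; exists 0.
- have [->|yr] := eqVneq y (root t1); first by rewrite ir => <-; exists 0.
  by rewrite iterSr => /IH [j <-]; exists j.+1; rewrite iterSr /= (negPf yr).
Qed.

Lemma below_join_r (x y : t2) :
  below (Some (inr x) : t) (Some (inr y) : t) = below x y.
Proof.
have [r1 _ _ _] := bin2.
have iN i : iter i (@par T t) None = None by elim: i => //= i ->.
have ir i : iter i (@par T t2) (root t2) = root t2 by elim: i => //= i ->.
apply/belowP/belowP; case=> i; elim: i y => [|i IH] y.
- by case=> ->; exists 0.
- rewrite iterSr /=; case: eqP => [_|_ /IH [j <-]]; first by rewrite iN.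
  by exists j.+1; rewrite iterSr.
- by move=> /= ->; exists 0.
- have [->|yr] := eqVneq y (root t2); first by rewrite ir => <-; exists 0.
  by rewrite iterSr => /IH [j <-]; exists j.+1; rewrite iterSr /= (negPf yr).
Qed.

Lemma below_join_lr (x : t1) (y : t2) :
  below (Some (inl x) : t) (Some (inr y) : t) = false.
Proof.
have iN i : iter i (@par T t) None = None by elim: i => //= i ->.
apply/belowP; case=> i; elim: i y => [|i IH] y //; rewrite iterSr /=.
by case: eqP => _; [rewrite iN | apply: IH].
Qed.

Lemma below_join_rl (x : t2) (y : t1) :
  below (Some (inr x) : t) (Some (inl y) : t) = false.
Proof.
have iN i : iter i (@par T t) None = None by elim: i => //= i ->.
apply/belowP; case=> i; elim: i y => [|i IH] y //; rewrite iterSr /=.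
by case: eqP => _; [rewrite iN | apply: IH].
Qed.

Lemma leaf_join_l v : v \in A -> leaf t v = Some (inl (leaf t1 v)).
Proof. by move=> /= ->. Qed.

Lemma leaf_join_r v : v \in B -> leaf t v = Some (inr (leaf t2 v)).
Proof. by move=> vB /=; rewrite (disjointFl dAB). Qed.

Lemma binary_join : binary_on t (A :|: B).
Proof.
have [_ d1 k1 i1] := bin1; have [_ d2 k2 i2] := bin2.
have inl_inj : injective (fun y : t1 => Some (inl y) : t) by move=> ? ? [].
have inr_inj : injective (fun y : t2 => Some (inr y) : t) by move=> ? ? [].
split=> //.
- case=> [[x|x]|] //= _; case: eqP => //= /eqP; [exact: d1|exact: d2].
- case=> [[x|x]|].
  + have -> : kids (Some (inl x) : t) = [set (Some (inl y) : t) | y in kids x].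
      apply/setP => -[[y|y]|]; rewrite !inE /=.
      * rewrite (mem_imset _ _ inl_inj) inE.
        by case: (y == root t1).
      * by case: (y == root t2); apply/esym/imsetP => -[].
      * by apply/esym/imsetP => -[].
    rewrite card_imset // k1; congr (if _ then _ else _).
    apply/imsetP/imsetP; case=> v vA.
      by move=> ->; exists v; rewrite ?inE ?vA // leaf_join_l.
    case/setUP: vA => vA; last by rewrite leaf_join_r.
    by rewrite leaf_join_l // => -[->]; exists v.
  + have -> : kids (Some (inr x) : t) = [set (Some (inr y) : t) | y in kids x].
      apply/setP => -[[y|y]|]; rewrite !inE /=.
      * by case: (y == root t1); apply/esym/imsetP => -[].
      * rewrite (mem_imset _ _ inr_inj) inE.
        by case: (y == root t2).
      * by apply/esym/imsetP => -[].
    rewrite card_imset // k2; congr (if _ then _ else _).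
    apply/imsetP/imsetP; case=> v vA.
      by move=> ->; exists v; rewrite ?inE ?vA ?orbT // leaf_join_r.
    case/setUP: vA => vA; first by rewrite leaf_join_l.
    by rewrite leaf_join_r // => -[->]; exists v.
  + have -> : kids (None : t) = [set (Some (inl (root t1)) : t); Some (inr (root t2))].
      apply/setP => -[[y|y]|]; rewrite !inE //=.
        by rewrite (inj_eq inl_inj); case: ifP.
      by rewrite (inj_eq inr_inj); case: ifP.
    by rewrite cards2 ifF //; apply/imsetP => -[].
- move=> u v /setUP[] uS /setUP[] vS.
  + by rewrite !leaf_join_l // => -[]; apply: i1.
  + by rewrite leaf_join_l // leaf_join_r.
  + by rewrite leaf_join_r // leaf_join_l.
  + by rewrite !leaf_join_r // => -[]; apply: i2.
Qed.

Lemma below_leaf_join (P : {set T} -> Prop) : P (A :|: B) ->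
  (forall x : t1, P [set v in A | below x (leaf t1 v)]) ->
  (forall x : t2, P [set v in B | below x (leaf t2 v)]) ->
  forall x : t, P [set v in A :|: B | below x (leaf t v)].
Proof.
move=> PAB P1 P2 [[x|x]|].
- rewrite (_ : [set _ in _ | _] = [set v in A | below x (leaf t1 v)]) //.
  apply/setP => v; rewrite !in_set.
  have [vA|vA] := boolP (v \in A); first by rewrite leaf_join_l // below_join_l.
  have [vB|//] := boolP (v \in B); first by rewrite leaf_join_r // below_join_lr.
- rewrite (_ : [set _ in _ | _] = [set v in B | below x (leaf t2 v)]) //.
  apply/setP => v; rewrite !in_set.
  have [vA|vA] := boolP (v \in A).
    by rewrite leaf_join_l // below_join_rl (disjointFr dAB).
  have [vB|//] := boolP (v \in B); first by rewrite leaf_join_r // below_join_r.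
- rewrite (_ : [set _ in _ | _] = A :|: B) //.
  by apply/setP => v; rewrite inE below_joinN andbT.
Qed.

End Join.

Lemma dec_binary (T : finType) (P : {set T} -> Prop) S : dec P S ->
  exists2 t : rooted T, binary_on t S
    & forall x : t, P [set v in S | below x (leaf t v)].
Proof.
elim=> {S} [x Px|A B dAB _ [t1 b1 p1] _ [t2 b2 p2] PAB].
  exists (@Rooted T unit id tt (fun _ => 0) (fun _ => tt)).
    split.
    - by [].
    - by case.
    - case; rewrite ifT; first by apply: eq_card0 => -[]; rewrite !inE.
      by apply/imsetP; exists x; rewrite ?inE.
    - by move=> u v; rewrite !inE => /eqP -> /eqP ->.
  case; rewrite (_ : [set _ in _ | _] = [set x]) //.
  by apply/setP => v; rewrite !inE /below connect0 andbT.
exists (join t1 t2 A); first exact: binary_join.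
exact: below_leaf_join.
Qed.

(** * From a rooted binary tree to a rank-decomposition *)

Section TreeOf.
Variables (T : finType) (t : rooted T).
Hypothesis bin : binary_on t setT.
Hypothesis T_gt1 : 1 < #|T|.

Definition edge_rel : rel t := fun x y =>
  ((x != root t) && (par x == y)) || ((y != root t) && (par y == x)).

Lemma par_neq (x : t) : x != root t -> par x != x.
Proof.
have [_ d _ _] := bin; move=> /d; apply: contraTneq => ->; by rewrite ltnn.
Qed.

Lemma edge_sym : symmetric edge_rel.
Proof. by move=> x y; rewrite /edge_rel orbC. Qed.

Lemma edge_irr : irreflexive edge_rel.
Proof.
move=> x; rewrite /edge_rel orbb; case: eqP => //= /eqP /par_neq.
exact: negbTE.
Qed.

Definition graph_of : sgraph t := SGraph edge_sym edge_irr.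

Lemma edge_par (x : t) : x != root t -> edge_rel x (par x).
Proof. by move=> xr; rewrite /edge_rel xr eqxx. Qed.

Lemma depth_ind (P : t -> Prop) : P (root t) ->
  (forall x, x != root t -> P (par x) -> P x) -> forall x, P x.
Proof.
have [_ d _ _] := bin; move=> P0 IH x.
have [k] := ubnP (depth x); elim: k x => // k IHk x dx.
have [->//|xr] := eqVneq x (root t); apply: IH => //; apply: IHk.
exact: leq_trans (d x xr) dx.
Qed.

Lemma graph_of_connected : connected_graph graph_of.
Proof.
have cr x : connect edge_rel x (root t).
  move: x; apply: depth_ind => [|x xr]; first exact: connect0.
  by apply: connect_trans; apply/connect1/edge_par.
move=> x y; apply: connect_trans (cr x) _.
by rewrite (sym_connect_sym edge_sym).
Qed.

(* Both neighbours on a cycle of a vertex of maximal depth are its parent. *)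
Lemma graph_of_acyclic : acyclic graph_of.
Proof.
have [_ d _ _] := bin.
move=> c /andP[cyc uc]; rewrite ltnNge; apply/negP => c3.
case: c cyc uc c3 => // a c0 cyc uc c3.
set c := a :: c0 in cyc uc c3.
have [x xc xmax] : exists2 x, x \in c & forall y, y \in c -> depth y <= depth x.
  have ac : a \in c by rewrite inE eqxx.
  by exists [arg max_(y > a in c) depth y]; case: arg_maxnP.
have up y : y \in c -> edge_rel x y -> par x = y.
  move=> yc; case/orP=> /andP[r /eqP //] e.
  by have := d _ r; rewrite e ltnNge xmax.
have nc : next c x \in c by rewrite mem_next.
have pc : prev c x \in c by rewrite mem_prev.
have e1 : par x = next c x := up _ nc (next_cycle cyc xc).
have pe : edge_rel (prev c x) x := prev_cycle cyc xc.
rewrite edge_sym in pe; have e2 := up _ pc pe.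
have [i s es] := rot_to xc.
have us : uniq (x :: s) by rewrite -es rot_uniq.
have s2 : 2 < size (x :: s) by rewrite -es size_rot.
have : next c (next c x) = x by rewrite -e1 e2 next_prev.
have nx z : next c z = next (x :: s) z by rewrite -es next_rot.
rewrite !nx; case: s us s2 {es nx} => [|y [|z s]] //= us _.
rewrite eqxx; case/and3P: us; rewrite !inE !negb_or => /and3P[xy xz _] _ _.
by rewrite [y == x]eq_sym (negPf xy) eqxx => zx; rewrite zx eqxx in xz.
Qed.

Lemma kids_par (x : t) : x != root t -> par x \notin kids x.
Proof.
have [_ d _ _] := bin; move=> xr; rewrite inE; apply/negP => /andP[pr /eqP e].
have := d _ xr; have := d _ pr; rewrite e => a b.
by have := ltn_trans a b; rewrite ltnn.
Qed.

Lemma degree_graph_of (x : t) : degree graph_of x = #|kids x| + (x != root t).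
Proof.
rewrite /degree; have [->|xr] /= := eqVneq x (root t).
  by rewrite addn0; apply: eq_card => y; rewrite !inE /edge_rel eqxx.
rewrite addnC -[X in X + _](cards1 (par x)) -cardsUI setIC.
rewrite (_ : kids x :&: _ = set0) ?cards0 ?addn0.
  by apply: eq_card => y; rewrite !inE /edge_rel xr /= eq_sym.
apply/setP => y; rewrite in_setI in_set1 in_set0 andbC.
by case: eqP => //= ->; apply/negbTE/kids_par.
Qed.

(** Were the root a leaf, it would have no kids and be the only node, whereas [leaf] embeds [T],
    which has more than one element. *)
Lemma root_kids : #|kids (root t)| = 2.
Proof.
have [r d k i] := bin; rewrite k; case: ifP => // rl; exfalso.
have k0 : kids (root t) = set0 by apply/eqP; rewrite -cards_eq0 k rl.
have xr x : x = root t.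
  move: x; apply: depth_ind => // x xr px.
  have : x \in kids (root t) by rewrite inE xr px eqxx.
  by rewrite k0 inE.
move: T_gt1; rewrite -cardsT -(card_in_imset i) ltnNge; apply/negP; rewrite negbK.
by rewrite -(cards1 (root t)); apply/subset_leq_card/subsetP => y _; rewrite inE (xr y).
Qed.

Lemma below_refl (x : t) : below x x.
Proof. exact: connect0. Qed.

Lemma below_par (x y : t) : below x (par y) -> below x y.
Proof. exact/connect_trans/fconnect1. Qed.

Lemma below_step (x y : t) : below x y -> x = y \/ below x (par y).
Proof.
case/belowP => -[|i]; first by left.
by rewrite iterSr => h; right; apply/belowP; exists i.
Qed.

Lemma par_not_below (x : t) : x != root t -> ~~ below x (par x).
Proof.
have [r d _ _] := bin; move=> xr; apply/negP => /belowP[j].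
have : depth (iter j (@par T t) (par x)) <= depth (par x).
  elim: j => //= j; apply: leq_trans.
  by case: (eqVneq (iter j (@par T t) (par x)) (root t)) => [->|/d/ltnW //]; rewrite r.
by move=> + e; rewrite e leqNgt d.
Qed.

Let del (x : t) := del_edge graph_of x (par x).

Lemma del_sym (x : t) : connect_sym (del x).
Proof.
apply: sym_connect_sym => u v; rewrite /del /del_edge /= edge_sym; congr (_ && ~~ _).
by rewrite !inE !xpair_eqE orbC; congr (_ || _); rewrite andbC.
Qed.

Lemma del_up (x z : t) : x != root t -> z != root t -> z != x -> del x z (par z).
Proof.
have [r d _ _] := bin; move=> xr zr zx.
rewrite /del /del_edge /= edge_par // !inE !xpair_eqE (negPf zx) /=.
apply/negP => /andP[/eqP e1 /eqP e2].
have := d _ zr; have := d _ xr; rewrite -e1 e2 => a b.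
by have := ltn_trans a b; rewrite ltnn.
Qed.

(** The edge from [x] to its parent is the only one that leaves the subtree below [x]. *)
Lemma del_below (x u v : t) : x != root t -> del x u v -> below x u = below x v.
Proof.
have [r d _ _] := bin.
have key a b : x != root t -> a != root t -> par a = b -> (a, b) != (x, par x) ->
    below x a = below x b.
  move=> xr ar <- ne; apply/idP/idP => [/below_step[e|//]|/below_par //].
  by rewrite e eqxx in ne.
move=> xr; rewrite /del /del_edge !inE negb_or => /andP[+ /andP[n1 n2]].
case/orP=> /andP[ur /eqP e]; first exact: key.
by apply/esym/key => //; apply: contra n2; rewrite !xpair_eqE andbC.
Qed.

Lemma connect_del (x z : t) : x != root t -> connect (del x) x z = below x z.
Proof.
move=> xr; apply/idP/idP.
  case/connectP => p; elim/last_ind: p z => [|p y IH] z /=.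
    by move=> _ ->; apply: below_refl.
  rewrite rcons_path last_rcons => /andP[pp e] ->.
  by rewrite -(del_below xr e); apply: IH.
case/belowP => i; elim: i z => [|i IH] z; first by move=> /= ->.
have [->//|zx] := eqVneq z x.
rewrite iterSr => h; have := IH _ h.
have [e|zr] := eqVneq z (root t).
  by rewrite e; have [-> _ _ _] := bin.
by rewrite ![connect _ x _]del_sym; apply: connect_trans; apply/connect1/del_up.
Qed.

(** Outside the subtree of [x], parent pointers lead to the root without crossing the deleted edge,
    so all these nodes are connected through the root. *)
Lemma connect_del_par (x z : t) : x != root t ->
  connect (del x) (par x) z = ~~ below x z.
Proof.
move=> xr; apply/idP/idP.
  case/connectP => p; elim/last_ind: p z => [|p y IH] z /=.
    by move=> _ ->; apply: par_not_below.
  rewrite rcons_path last_rcons => /andP[pp e] ->.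
  by rewrite -(del_below xr e); apply: IH.
have up y : ~~ below x y -> connect (del x) y (root t).
  move: y; apply: depth_ind => // y yr IH yx.
  apply: connect_trans (IH _); last by apply: contra yx; apply: below_par.
  apply/connect1/del_up => //.
  by apply: contraNneq yx => ->; apply: below_refl.
move=> /up zr; apply: connect_trans (up _ (par_not_below xr)) _.
by rewrite del_sym.
Qed.

(** The degree is 2 at the root, 1 at the labelled nodes and 3 at all others. *)
Lemma leaves_graph_of x : (x \in codom (@leaf T t)) = (degree graph_of x == 1).
Proof.
have [r d k i] := bin; rewrite degree_graph_of.
have E y : (y \in codom (@leaf T t)) = (y \in (@leaf T t) @: setT).
  by apply/codomP/imsetP => -[v]; [exists v|exists v].
have [->|xr] := eqVneq x (root t).
  rewrite root_kids E; apply/negbTE/negP => h; move: root_kids.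
  by rewrite k h.
by rewrite k -E; case: (x \in _).
Qed.

Lemma card_node_gt1 : 1 < #|t|.
Proof.
rewrite -cardsT; apply: leq_trans (subset_leq_card (subsetT (kids (root t)))).
by rewrite root_kids.
Qed.

Lemma degree_le3 x : degree graph_of x <= 3.
Proof.
have [_ _ k _] := bin; rewrite degree_graph_of k.
by case: ifP => _; case: (x != root t).
Qed.

Lemma leaf_inj : injective (@leaf T t).
Proof. by have [_ _ _ i] := bin; move=> u v; apply: i; rewrite in_setT. Qed.

Definition decomposition_of : rank_decomposition T :=
  RankDecomposition card_node_gt1 (conj graph_of_connected graph_of_acyclic)
    degree_le3 leaf_inj leaves_graph_of.

End TreeOf.

(** Seen from its upper end, the side of an edge is the complement of a subtree; hence the closure
    of [P] under complement. The root is kept as a vertex of degree two. *)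
Lemma dec_rank_decomposition (T : finType) (P : {set T} -> Prop) : 1 < #|T| ->
  (forall S, P S -> P (~: S)) -> dec P setT ->
  exists D : rank_decomposition T,
    forall x y : rd_node D, rd_tree D x y -> P (edge_side x y).
Proof.
move=> T1 PC /dec_binary[t bin Pt]; exists (decomposition_of bin T1).
move=> x y /= /orP[] /andP[xr /eqP e].
  rewrite (_ : edge_side _ _ = [set v in setT | below x (leaf t v)]) //.
  by apply/setP => v; rewrite !inE -e /= connect_del.
rewrite (_ : edge_side _ _ = ~: [set v in setT | below y (leaf t v)]); first exact: PC.
apply/setP => v; rewrite !inE -(connect_del_par bin) //= -e.
apply: eq_connect => a b; rewrite /del_edge; congr (_ && ~~ _).
by rewrite !inE orbC.
Qed.

(** * Schmidt ranks of products of components *)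

Section Schmidt.
Import GRing.Theory Num.Theory.
Local Open Scope ring_scope.
Variable C : numClosedFieldType.
Local Notation bits n := {ffun 'I_n -> bool}.

Section Fixed.
Variable m : nat.
Implicit Types (f g phi psi : bits m -> C) (A B K S : {set 'I_m}).
Implicit Types (M : bool -> bool -> C) (U V : bool -> bool -> bool -> C).
Implicit Types (p q : 'I_m).

Definition depends S f := forall x y : bits m, {in S, x =1 y} -> f x = f y.

(** Schmidt rank at most 2^w, witnessed by an explicit sum of products, so that gates can be applied
    to the factors. The free index type lets a gate across the cut replace [I] by [I * bool]. *)
Definition schmidt_le phi A B w := exists (I : finType) (f g : I -> bits m -> C),
  [/\ (#|I| <= 2 ^ w)%N, forall i, depends A (f i), forall i, depends B (g i)
    & phi = fun x => \sum_i f i x * g i x].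

Definition gate1 M p phi : bits m -> C :=
  fun x => \sum_b M (x p) b * phi (Preparation.upd x p b).

(** An arbitrary operator of operator Schmidt rank at most 2; unitarity is irrelevant for rank
    bounds. *)
Definition gate2 (U V : bool -> bool -> bool -> C) p q phi : bits m -> C :=
  fun x => \sum_a gate1 (U a) p (gate1 (V a) q phi) x.

Lemma depends_sub S S' f : S \subset S' -> depends S f -> depends S' f.
Proof. by move=> SS' df x y e; apply: df => v /(subsetP SS') /e. Qed.

Lemma depends_upd S f p b x : depends S f -> p \notin S ->
  f (Preparation.upd x p b) = f x.
Proof.
move=> df pS; apply: df => v vS; rewrite ffunE; case: eqP => // vp.
by rewrite -vp vS in pS.
Qed.

Lemma depends_mul S f g : depends S f -> depends S g ->
  depends S (fun x => f x * g x).
Proof. by move=> df dg x y e; rewrite (df x y e) (dg x y e). Qed.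

Lemma depends_prod (L : Type) (r : seq L) (P : pred L) (f : L -> bits m -> C) S :
  (forall l, P l -> depends S (f l)) ->
  depends S (fun x => \prod_(l <- r | P l) f l x).
Proof. by move=> df x y e; apply: eq_bigr => l Pl; apply: df. Qed.

Lemma depends_gate1 S M p f : p \in S -> depends S f -> depends S (gate1 M p f).
Proof.
move=> pS df x y e; apply: eq_bigr => b _; rewrite (e p pS); congr (_ * _).
by apply: df => v vS; rewrite !ffunE e.
Qed.

Lemma depends_gate2 S U V p q f : p \in S -> q \in S ->
  depends S f -> depends S (gate2 U V p q f).
Proof.
move=> pS qS df x y e; apply: eq_bigr => a _.
by apply: depends_gate1 e => //; apply: depends_gate1.
Qed.

Lemma gate1_mulr S M p f g : depends S g -> p \notin S ->
  gate1 M p (fun x => f x * g x) = fun x => gate1 M p f x * g x.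
Proof.
move=> dg pS; apply/funext => x; rewrite [RHS]mulr_suml; apply: eq_bigr => b _.
by rewrite (depends_upd _ _ dg pS) mulrA.
Qed.

Lemma gate1_mull S M p f g : depends S f -> p \notin S ->
  gate1 M p (fun x => f x * g x) = fun x => f x * gate1 M p g x.
Proof.
move=> df pS; rewrite -[LHS](_ : gate1 M p (fun x => g x * f x) = _).
  by rewrite (gate1_mulr _ _ df pS); apply/funext => x; rewrite mulrC.
by congr (gate1 M p _); apply/funext => x; rewrite mulrC.
Qed.

Lemma gate1_sum (I : finType) (f : I -> bits m -> C) M p :
  gate1 M p (fun x => \sum_i f i x) = fun x => \sum_i gate1 M p (f i) x.
Proof.
apply/funext => x; rewrite /gate1 exchange_big /=.
by apply: eq_bigr => b _; rewrite mulr_sumr.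
Qed.

Lemma gate2_mulr S U V p q f g : depends S g -> p \notin S -> q \notin S ->
  gate2 U V p q (fun x => f x * g x) = fun x => gate2 U V p q f x * g x.
Proof.
move=> dg pS qS; apply/funext => x; rewrite [RHS]mulr_suml.
by apply: eq_bigr => a _; rewrite (gate1_mulr _ _ dg qS) (gate1_mulr _ _ dg pS).
Qed.

Lemma gate2_mulC U V p q f g :
  gate2 U V p q (fun x => f x * g x) = gate2 U V p q (fun x => g x * f x).
Proof. by congr (gate2 U V p q _); apply/funext => x; rewrite mulrC. Qed.

Lemma gate2_split S S' U V p q f g : depends S f -> depends S' g ->
    q \notin S -> p \notin S' -> q \in S' ->
  gate2 U V p q (fun x => f x * g x) =
  fun x => \sum_a gate1 (U a) p f x * gate1 (V a) q g x.
Proof.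
move=> df dg qS pS' qS'; apply/funext => x; apply: eq_bigr => a _.
rewrite (gate1_mull _ _ df qS).
by rewrite (gate1_mulr _ _ (depends_gate1 _ qS' dg) pS').
Qed.

Lemma gate2_sum (I : finType) (f : I -> bits m -> C) U V p q :
  gate2 U V p q (fun x => \sum_i f i x) = fun x => \sum_i gate2 U V p q (f i) x.
Proof.
apply/funext => x; rewrite [RHS]exchange_big; apply: eq_bigr => a _.
by rewrite !gate1_sum.
Qed.

Lemma schmidt_sym phi A B w : schmidt_le phi A B w -> schmidt_le phi B A w.
Proof.
case=> I [f [g [cI df dg ->]]]; exists I, g, f; split=> //.
by apply/funext => x; apply: eq_bigr => i _; rewrite mulrC.
Qed.

Lemma schmidt_sub phi A B A' B' w w' : A \subset A' -> B \subset B' -> (w <= w')%N ->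
  schmidt_le phi A B w -> schmidt_le phi A' B' w'.
Proof.
move=> AA' BB' ww' [I [f [g [cI df dg ->]]]]; exists I, f, g; split=> //.
- by apply: leq_trans cI _; rewrite leq_pexp2l.
- by move=> i; apply: depends_sub (df i).
- by move=> i; apply: depends_sub (dg i).
Qed.

Lemma schmidt_mulr phi g A B S w : depends S g -> schmidt_le phi A B w ->
  schmidt_le (fun x => phi x * g x) A (B :|: S) w.
Proof.
move=> dg [I [f [h [cI df dh ->]]]]; exists I, f, (fun i x => h i x * g x).
split=> // [i|]; last first.
  by apply/funext => x; rewrite mulr_suml; apply: eq_bigr => i _; rewrite mulrA.
by apply: depends_mul; [apply: depends_sub (dh i)|apply: depends_sub dg];
  rewrite ?subsetUl ?subsetUr.
Qed.

Lemma schmidt_trivial phi A w : depends A phi -> schmidt_le phi A set0 w.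
Proof.
move=> dphi; exists 'I_1, (fun _ => phi), (fun _ _ => 1); split=> //.
  by rewrite card_ord expn_gt0.
by apply/funext => x; rewrite big_ord1 mulr1.
Qed.

(** One term for each value of the qubit [p]. *)
Lemma schmidt_single phi K p : depends K phi -> schmidt_le phi [set p] (K :\ p) 1.
Proof.
move=> dphi; exists bool, (fun b x => (x p == b)%:R),
  (fun b x => phi (Preparation.upd x p b)); split.
- by rewrite card_bool.
- by move=> b x y /(_ p) ->; rewrite ?inE.
- move=> b x y e; apply: dphi => v vK; rewrite !ffunE.
  by case: eqP => // /eqP vp; apply: e; rewrite !inE vp.
- apply/funext => x; rewrite (bigD1 (x p)) //= eqxx mul1r big1 ?addr0; last first.
    by move=> b bp; rewrite eq_sym (negPf bp) mul0r.
  by congr phi; apply/ffunP => v; rewrite ffunE; case: eqP => // ->.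
Qed.

Lemma schmidt_gate1 phi M A B p w : p \in A -> p \notin B ->
  schmidt_le phi A B w -> schmidt_le (gate1 M p phi) A B w.
Proof.
move=> pA pB [I [f [g [cI df dg ->]]]]; exists I, (fun i => gate1 M p (f i)), g.
split=> // [i|]; first exact: depends_gate1.
rewrite gate1_sum; apply/funext => x; apply: eq_bigr => i _.
by rewrite (gate1_mulr _ _ (dg i) pB).
Qed.

Lemma schmidt_gate2 phi U V A B p q w : p \in A -> q \in A -> p \notin B -> q \notin B ->
  schmidt_le phi A B w -> schmidt_le (gate2 U V p q phi) A B w.
Proof.
move=> pA qA pB qB [I [f [g [cI df dg ->]]]].
exists I, (fun i => gate2 U V p q (f i)), g.
split=> // [i|]; first exact: depends_gate2.
rewrite gate2_sum; apply/funext => x; apply: eq_bigr => i _.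
by rewrite (gate2_mulr _ _ _ (dg i) pB qB).
Qed.

Lemma schmidt_gate2_cross phi U V A B p q w : p \in A -> q \in B ->
    p \notin B -> q \notin A ->
  schmidt_le phi A B w -> schmidt_le (gate2 U V p q phi) A B w.+1.
Proof.
move=> pA qB pB qA [I [f [g [cI df dg ->]]]].
exists (I * bool)%type, (fun ia => gate1 (U ia.2) p (f ia.1)),
  (fun ia => gate1 (V ia.2) q (g ia.1)).
split=> [|i|i|]; [|exact: depends_gate1|exact: depends_gate1|].
  by rewrite card_prod card_bool expnSr leq_mul2r.
rewrite gate2_sum; apply/funext => x.
rewrite -(pair_bigA _ (fun i a => gate1 (U a) p (f i) x * gate1 (V a) q (g i) x)) /=.
by apply: eq_bigr => i _; rewrite (gate2_split _ _ (df i) (dg i)).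
Qed.

(** The invariant of one group, with [k] as its gate budget. An empty group carries a scalar and has
    no tree; such groups arise from measurements and mergers. *)
Definition component K phi k := depends K phi /\
  (K != set0 -> exists w, [/\ (0 < w)%N, (#|K| + w <= k + 2)%N
     & dec (fun S => schmidt_le phi S (K :\: S) w) K]).

Lemma component0 phi : depends set0 phi -> component set0 phi 0.
Proof. by split=> //; rewrite eqxx. Qed.

Lemma component1 p phi : depends [set p] phi -> component [set p] phi 0.
Proof.
move=> dphi; split=> // _; exists 1%N; split=> //; first by rewrite cards1.
by apply: Dec1; apply: schmidt_single.
Qed.

Lemma component_gate1 K phi k M p : p \in K ->
  component K phi k -> component K (gate1 M p phi) k.
Proof.
move=> pK [dphi h]; split=> [|K0]; first exact: depends_gate1.
have [w [w0 kw d]] := h K0; exists w; split=> //.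
apply: dec_sub d => S SK s.
have [pS|pS] := boolP (p \in S); first by apply: schmidt_gate1; rewrite ?inE ?pS.
by apply/schmidt_sym/schmidt_gate1/schmidt_sym; rewrite ?inE ?pS.
Qed.

(** The tree is kept. A cut separating [p] from [q] at most doubles its Schmidt rank; for any other
    cut the gate is local to one side. *)
Lemma component_gate2 K phi k U V p q : p \in K -> q \in K ->
  component K phi k -> component K (gate2 U V p q phi) k.+1.
Proof.
move=> pK qK [dphi h]; split=> [|K0]; first exact: depends_gate2.
have [w [w0 kw d]] := h K0; exists w.+1; split=> //; first by rewrite addnS addSn ltnS.
apply: dec_sub d => S SK s.
have ss A B phi' : schmidt_le phi' A B w -> schmidt_le phi' A B w.+1.
  by apply: schmidt_sub.
have [pS|pS] := boolP (p \in S); have [qS|qS] := boolP (q \in S).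
- by apply: schmidt_gate2; rewrite ?inE ?pS ?qS //; apply: ss.
- by apply: schmidt_gate2_cross; rewrite ?inE ?pS ?qS.
- by apply/schmidt_sym/schmidt_gate2_cross/schmidt_sym; rewrite ?inE ?pS ?qS.
- by apply/schmidt_sym/schmidt_gate2/schmidt_sym; rewrite ?inE ?pS ?qS //; apply: ss.
Qed.

(* The gate hooks a new edge between the pendant edges at the leaves p and q:
   re-root the second tree at q and graft it at p. *)
Lemma component_merge K1 K2 phi1 phi2 k1 k2 U V p q : [disjoint K1 & K2] ->
    p \in K1 -> q \in K2 -> component K1 phi1 k1 -> component K2 phi2 k2 ->
  component (K1 :|: K2) (gate2 U V p q (fun x => phi1 x * phi2 x)) (k1 + k2).+1.
Proof.
move=> dK pK1 qK2 [d1 h1] [d2 h2].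
have pK2 : p \notin K2 by rewrite (disjointFr dK pK1).
have qK1 : q \notin K1 by rewrite (disjointFl dK qK2).
have K10 : K1 != set0 by apply/set0Pn; exists p.
have K20 : K2 != set0 by apply/set0Pn; exists q.
have [w1 [w1_gt0 kw1 t1]] := h1 K10; have [w2 [w2_gt0 kw2 t2]] := h2 K20.
set K := K1 :|: K2; set phi := gate2 U V p q _.
have dphi : depends K phi.
  apply: depends_gate2; rewrite ?inE ?pK1 ?qK2 ?orbT //.
  by apply: depends_mul; [apply: depends_sub d1|apply: depends_sub d2];
    rewrite ?subsetUl ?subsetUr.
split=> // _; pose w := maxn w1 w2; exists w; split.
- by rewrite leq_max w1_gt0.
- rewrite cardsU; move: dK; rewrite -setI_eq0 => /eqP ->; rewrite cards0 subn0.
  (* This uses that [w1] and [w2] are positive; the unit saved turns the constants 2 + 2 into the 3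
     allowed by the budget increased by one gate. *)
  have : (w <= w1 + w2 - 1)%N by rewrite /w; case: (leqP w1 w2) => _; lia.
  by lia.
pose P S := schmidt_le phi S (K :\: S) w.
have single v : P [set v].
  by apply: schmidt_sub (schmidt_single v dphi); rewrite // leq_max w1_gt0.
(* Both [p] and [q] lie outside [S], so the gate acts on the complementary side only. *)
have away1 S : S \subset K1 -> p \notin S -> schmidt_le phi1 S (K1 :\: S) w1 -> P S.
  move=> SK pS s; apply/schmidt_sym/schmidt_gate2.
  - by rewrite !inE pK1 pS.
  - by rewrite !inE qK2 orbT andbT; apply: contra qK1; apply: (subsetP SK).
  - by [].
  - by apply: contra qK1; apply: (subsetP SK).
  apply/schmidt_sym/(schmidt_sub _ _ _ (schmidt_mulr d2 s)); rewrite ?leq_maxl //.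
  apply/subsetP => v; rewrite !inE => /orP[/andP[-> ->]//|vK2]; rewrite vK2 orbT andbT.
  by apply: contraL vK2 => /(subsetP SK) vK1; rewrite (disjointFr dK vK1).
(* Adding all of [K2] brings [q] to the side of [p], so the gate is again local to one side. *)
have near1 S : S \subset K1 -> p \in S -> schmidt_le phi1 S (K1 :\: S) w1 -> P (S :|: K2).
  move=> SK pS s; apply: schmidt_gate2.
  - by rewrite !inE pS.
  - by rewrite !inE qK2 orbT.
  - by rewrite !inE pS.
  - by rewrite !inE qK2 orbT.
  have := schmidt_mulr d2 (schmidt_sym s); move/schmidt_sym; apply: schmidt_sub.
  - by [].
  - apply/subsetP => v; rewrite !inE => /andP[vS vK1]; rewrite negb_or vS vK1.
    by rewrite (disjointFr dK vK1).
  - exact: leq_maxl.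
have away2 S : S \subset K2 -> q \notin S -> schmidt_le phi2 S (K2 :\: S) w2 -> P S.
  move=> SK qS s; apply/schmidt_sym; rewrite /phi gate2_mulC; apply: schmidt_gate2.
  - by rewrite !inE pK1 andbT; apply: contra pK2; apply: (subsetP SK).
  - by rewrite !inE qK2 qS orbT.
  - by apply: contra pK2; apply: (subsetP SK).
  - by [].
  apply/schmidt_sym/(schmidt_sub _ _ _ (schmidt_mulr d1 s)); rewrite ?leq_maxr //.
  apply/subsetP => v; rewrite !inE => /orP[/andP[-> ->]|vK1]; rewrite ?orbT // vK1 andbT.
  by apply: contraL vK1 => /(subsetP SK) vK2; rewrite (disjointFl dK vK2).
(* The new edge: before the gate the state is a product across this cut, so afterwards two terms
   suffice. *)
have PK2 : P K2.
  apply: (@schmidt_sub _ K2 K1 _ _ 1); rewrite ?leq_max ?w1_gt0 //.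
    apply/subsetP => v vK1; rewrite !inE vK1 andbT.
    by rewrite (disjointFr dK vK1).
  apply/schmidt_sym/schmidt_gate2_cross => //.
  have := schmidt_mulr d2 (schmidt_trivial 0 d1).
  by rewrite set0U.
(* The leaf [q] becomes a child of the top node, next to the re-rooted rest, so no cut other than
   that of [K2] itself separates [q] from [p] without being a single leaf. *)
have decK2 : dec P K2.
  have [E|K2q] := eqVneq K2 [set q]; first by rewrite E; apply: Dec1; apply: single.
  rewrite -(setD1K qK2); apply: DecU.
  - by rewrite disjoints1 !inE eqxx.
  - by apply: Dec1; apply: single.
  - have t2' : dec (fun S => schmidt_le phi2 S (K2 :\: S) w2) (K2 :\ q).
      apply: dec_reroot => // S SK /schmidt_sym; apply: schmidt_sub => //.
      by apply/subsetP => v vS; rewrite !inE vS (subsetP SK).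
    apply: dec_sub t2' => S SK; apply: away2.
      by apply: subset_trans SK _; apply: subsetDl.
    by apply/negP => /(subsetP SK); rewrite !inE eqxx.
  - by rewrite (setD1K qK2).
apply: (dec_graft away1 near1 dK _ t1 pK1).
apply: DecU => //; [by rewrite disjoints1|by apply: Dec1; apply: single|].
by apply: near1; rewrite ?sub1set ?inE //; apply: schmidt_sub (schmidt_single p d1).
Qed.

(* c assigns a component to each qubit, and kk l bounds the number of two-qubit
   gates spent on component l (components may be empty). *)
Definition factored psi k := exists (L : finType) (c : 'I_m -> L)
    (phi : L -> bits m -> C) (kk : L -> nat),
  [/\ psi = fun x => \prod_l phi l x, (\sum_l kk l <= k)%N
    & forall l, component [set v | c v == l] (phi l) (kk l)].

Lemma factored_gate1 psi k M p : factored psi k -> factored (gate1 M p psi) k.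
Proof.
case=> L [c [phi [kk [-> ks h]]]].
exists L, c, (fun l => if l == c p then gate1 M p (phi l) else phi l), kk.
split=> // [|l]; last first.
  by case: eqP => // ->; apply: component_gate1 => //; rewrite inE.
have dR : depends [set~ p] (fun x => \prod_(l | l != c p) phi l x).
  apply: depends_prod => l lp; apply: depends_sub (proj1 (h l)).
  by apply/subsetP => v; rewrite !inE => /eqP vl; apply: contraNneq lp => <-; rewrite vl.
transitivity (gate1 M p (fun x => phi (c p) x * \prod_(l | l != c p) phi l x)).
  by congr (gate1 M p _); apply/funext => x; rewrite (bigD1 (c p)).
rewrite (gate1_mulr _ _ dR) ?inE ?eqxx //; apply/funext => x.
rewrite [RHS](bigD1 (c p)) //= eqxx; congr (_ * _).
by apply: eq_bigr => l /negPf ->.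
Qed.

Lemma factored_gate2 psi k U V p q :
  factored psi k -> factored (gate2 U V p q psi) k.+1.
Proof.
case=> L [c [phi [kk [-> ks h]]]].
have [cpq|cpq] := eqVneq (c p) (c q).
  exists L, c, (fun l => if l == c p then gate2 U V p q (phi l) else phi l),
    (fun l => kk l + (l == c p))%N.
  split=> [||l]; last first.
  - case: eqP => [->|_]; last by rewrite addn0.
    by rewrite addn1; apply: component_gate2 => //; rewrite inE ?cpq.
  - rewrite big_split /= (_ : (\sum_l (l == c p) = 1)%N) ?addn1 //.
    by rewrite (bigD1 (c p)) //= eqxx big1 // => l /negPf ->.
  have dR : depends (~: [set v | c v == c p]) (fun x => \prod_(l | l != c p) phi l x).
    apply: depends_prod => l lp; apply: depends_sub (proj1 (h l)).
    by apply/subsetP => v; rewrite !inE => /eqP ->.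
  transitivity (gate2 U V p q (fun x => phi (c p) x * \prod_(l | l != c p) phi l x)).
    by congr (gate2 U V p q _); apply/funext => x; rewrite (bigD1 (c p)).
  rewrite (gate2_mulr _ _ _ dR) ?inE ?eqxx ?cpq ?eqxx //; apply/funext => x.
  rewrite [RHS](bigD1 (c q)) //= eqxx; congr (_ * _).
  by apply: eq_bigr => l /negPf ->.
have cqp : (c q == c p) = false by rewrite eq_sym (negPf cpq).
pose K l := [set v | c v == l].
(* The merged group takes over the index [c p]; the index [c q] is left with an empty group, factor
   1 and budget 0. *)
exists L, (fun v => if c v == c q then c p else c v),
  (fun l => if l == c p then gate2 U V p q (fun x => phi (c p) x * phi (c q) x)
            else if l == c q then (fun=> 1) else phi l),
  (fun l => if l == c p then (kk (c p) + kk (c q)).+1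
            else if l == c q then 0%N else kk l).
split=> [||l].
- have dR : depends (~: (K (c p) :|: K (c q)))
      (fun x => \prod_(l | (l != c p) && (l != c q)) phi l x).
    apply: depends_prod => l /andP[lp lq]; apply: depends_sub (proj1 (h l)).
    by apply/subsetP => v; rewrite !inE => /eqP ->; rewrite negb_or lp.
  transitivity (gate2 U V p q (fun x => (phi (c p) x * phi (c q) x) *
      \prod_(l | (l != c p) && (l != c q)) phi l x)).
    congr (gate2 U V p q _); apply/funext => x.
    by rewrite (bigD1 (c p)) //= (bigD1 (c q)) ?cqp //= mulrA.
  rewrite (gate2_mulr _ _ _ dR) ?inE ?eqxx ?orbT //; apply/funext => x.
  rewrite [RHS](bigD1 (c p)) //= eqxx [X in _ = _ * X](bigD1 (c q)) ?cqp //=.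
  rewrite ?cqp ?eqxx mul1r; congr (_ * _).
  by apply: eq_bigr => l /andP[/negPf -> /negPf ->].
- rewrite (bigD1 (c p)) //= eqxx (bigD1 (c q)) ?cqp //=.
  rewrite ?cqp ?eqxx add0n addSn ltnS.
  apply: leq_trans ks; rewrite [leqRHS](bigD1 (c p)) //=.
  rewrite [X in (_ <= _ + X)%N](bigD1 (c q)) ?cqp //=.
  rewrite addnA leq_add2l; apply: eq_leq; apply: eq_bigr => l.
  by case/andP=> /negPf -> /negPf ->.
case: eqP => [->|/eqP lp].
  rewrite (_ : [set _ | _] = K (c p) :|: K (c q)).
    apply: component_merge; rewrite ?inE //; try exact: h.
    rewrite -setI_eq0; apply/eqP/setP => v; rewrite !inE.
    by apply/negP => /andP[/eqP -> /eqP e]; rewrite e eqxx in cpq.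
  apply/setP => v; rewrite !inE; case: (eqVneq (c v) (c q)) => [->|vq].
    by rewrite eqxx orbT.
  by rewrite orbF.
case: eqP => [->|/eqP lq].
  rewrite (_ : [set _ | _] = set0); first by apply: component0.
  apply/setP => v; rewrite !inE; case: (eqVneq (c v) (c q)) => [_|/negPf -> //].
  exact: negbTE.
rewrite (_ : [set _ | _] = K l); first exact: h.
apply/setP => v; rewrite !inE; case: (eqVneq (c v) (c q)) => // ->.
by rewrite ![_ == l]eq_sym (negPf lp) (negPf lq).
Qed.

Lemma factored_ket0 : factored (amplitude (ket0 C m)) 0.
Proof.
exists 'I_m, id, (fun l x => (~~ x l)%:R), (fun=> 0%N); split=> [||l].
- apply/funext => x; rewrite Preparation.amp_ket.
  case: eqP => [->|/eqP x0]; first by rewrite big1 // => l _; rewrite ffunE.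
  have [l xl] : exists l, x l.
    apply/existsP; apply: contraR x0; rewrite negb_exists => /forallP h.
    by apply/eqP/ffunP => l; rewrite ffunE; apply/negbTE/h.
  by rewrite (bigD1 l) //= xl mul0r.
- by rewrite big1.
rewrite (_ : [set _ | _] = [set l]); first by apply: component1 => x y e; rewrite e ?inE.
by apply/setP => v; rewrite !inE.
Qed.

End Fixed.

(** * Discarding and relabelling qubits *)

Section Pullback.
Variables (m m' : nat) (h : 'I_m -> 'I_m') (e : bits m -> bits m').
Hypothesis h_inj : injective h.
Hypothesis eh : forall x j, e x (h j) = x j.
Hypothesis eNh : forall x y j, j \notin codom h -> e x j = e y j.

(** Coordinates outside the image of [h] are constant in [e x] and create no dependency. The same
    setting covers a measurement, where [e] inserts the outcome, and an exchange of qubits, where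
    [h] is a transposition. *)
Lemma depends_pull S (f : bits m' -> C) :
  depends S f -> depends (h @^-1: S) (fun x => f (e x)).
Proof.
move=> df x y xy; apply: df => v vS.
have [/codomP[j vj]|] := boolP (v \in codom h); last exact: eNh.
by rewrite vj !eh; apply: xy; rewrite inE -vj.
Qed.

Lemma schmidt_pull phi A B w : schmidt_le phi A B w ->
  schmidt_le (fun x => phi (e x)) (h @^-1: A) (h @^-1: B) w.
Proof.
case=> I [f [g [cI df dg ->]]].
exists I, (fun i x => f i (e x)), (fun i x => g i (e x)).
by split=> // i; apply: depends_pull.
Qed.

Lemma component_pull K phi k : component K phi k ->
  component (h @^-1: K) (fun x => phi (e x)) k.
Proof.
case=> dphi hK; split=> [|K0]; first exact: depends_pull.
have [|w [w0 kw d]] := hK.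
  by apply: contraNneq K0 => ->; rewrite preimset0.
exists w; split=> //.
  apply: leq_trans kw; rewrite leq_add2r -(card_imset _ h_inj).
  by apply/subset_leq_card/subsetP => _ /imsetP[v + ->]; rewrite inE.
apply: dec_preim d K0 => // S SK /schmidt_pull.
by rewrite preimsetD.
Qed.

Lemma factored_pull psi k : factored psi k -> factored (fun x => psi (e x)) k.
Proof.
case=> L [c [phi [kk [-> ks hK]]]].
exists L, (fun v => c (h v)), (fun l x => phi l (e x)), kk; split=> // l.
rewrite (_ : [set _ | _] = h @^-1: [set v | c v == l]); first exact: component_pull.
by apply/setP => v; rewrite !inE.
Qed.

End Pullback.
End Schmidt.

(** * Two-qubit Clifford gates *)

Section Clifford.
Import GRing.Theory Num.Theory.
Local Open Scope ring_scope.
Local Open Scope sesquilinear_scope.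
Variable C : numClosedFieldType.
Local Notation bits n := {ffun 'I_n -> bool}.
Local Notation operator n := 'M[C]_#|{ffun 'I_n -> bool}|.
Local Notation paulis := [:: 1%:M; pauliX C; pauliY C; pauliZ C].

Lemma sum_ord2 (F : 'I_2 -> C) : \sum_i F i = \sum_b F (bit b).
Proof.
rewrite big_bool !big_ord_recl big_ord0 addr0 addrC.
by congr (F _ + F _); apply: val_inj.
Qed.

Lemma tensor_mul n (h k : 'I_n -> 'M[C]_2) :
  tensor h *m tensor k = tensor (fun j => h j *m k j).
Proof.
apply: Preparation.ent_ext => x z; rewrite Preparation.ent_mul Preparation.ent_oper.
transitivity (\prod_j \sum_b h j (bit (x j)) (bit b) * k j (bit b) (bit (z j))).
  rewrite bigA_distr_bigA; apply: eq_bigr => y _.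
  by rewrite !Preparation.ent_oper big_split.
by apply: eq_bigr => j _; rewrite mxE sum_ord2.
Qed.

Definition bits2 (a b : bool) : bits 2 := [ffun i => if i == ord0 then a else b].

Lemma bits2P (x : bits 2) : x = bits2 (x ord0) (x ord_max).
Proof.
apply/ffunP => j; rewrite ffunE; case: eqP => [->//|].
by case: j => -[|[|]] // i ne; [case: ne|congr (x _)]; apply: val_inj.
Qed.

Lemma sum_bits2 (F : bits 2 -> C) : \sum_x F x = \sum_a \sum_b F (bits2 a b).
Proof.
rewrite pair_bigA /= (reindex (fun ab : bool * bool => bits2 ab.1 ab.2)) //=.
exists (fun x : bits 2 => (x ord0, x ord_max)) => [[a b]|x] _; first by rewrite !ffunE.
by rewrite -bits2P.
Qed.

Definition pair2 (h k : 'M[C]_2) (j : 'I_2) := if j == ord0 then h else k.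

Lemma prod_ord2 (F : 'I_2 -> C) : \prod_i F i = F ord0 * F ord_max.
Proof.
rewrite !big_ord_recl big_ord0 mulr1; congr (_ * F _); exact: val_inj.
Qed.

Lemma tensor_pair2 (h : 'I_2 -> 'M[C]_2) :
  tensor h = tensor (pair2 (h ord0) (h ord_max)).
Proof.
by apply: Preparation.ent_ext => x y; rewrite !Preparation.ent_oper !prod_ord2.
Qed.

Lemma entry_pair2 h k a b c d :
  entry (tensor (pair2 h k)) (bits2 a b) (bits2 c d) =
  h (bit a) (bit c) * k (bit b) (bit d).
Proof. by rewrite Preparation.ent_oper prod_ord2 !ffunE. Qed.

Lemma tensor_pair2_mul h k h' k' : tensor (pair2 h k) *m tensor (pair2 h' k') =
  tensor (pair2 (h *m h') (k *m k')).
Proof. by rewrite tensor_mul tensor_pair2. Qed.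

Lemma tensor_pair2N h k :
  (tensor (pair2 (- h) k) = - tensor (pair2 h k)) *
  (tensor (pair2 h (- k)) = - tensor (pair2 h k)).
Proof.
split; apply: Preparation.ent_ext => x y; rewrite [RHS]mxE -/(entry _ _ _);
  by rewrite !Preparation.ent_oper !prod_ord2 /= mxE ?mulNr ?mulrN.
Qed.

Lemma pauli_sq (h : 'M[C]_2) : h \in paulis -> h *m h = 1%:M.
Proof.
rewrite !inE => /or4P[] /eqP ->; rewrite ?mulmx1 //;
  apply/matrixP => -[[|[|]] //= ?] [[|[|]] //= ?];
  rewrite !mxE !big_ord_recl big_ord0 !mxE /=;
  rewrite ?(mulr0, mul0r, mulr1, mul1r, addr0, add0r, mulrN, mulNr, opprK) //;
  by rewrite -expr2 sqrCi opprK.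
Qed.

Lemma pauli_anticommute (h k : 'M[C]_2) : h \in paulis -> k \in paulis ->
  [\/ h = 1%:M, k = 1%:M, h = k | h *m k = - (k *m h)].
Proof.
have anti h' k' : h' *m k' = - (k' *m h') -> k' *m h' = - (h' *m k') :> 'M[C]_2.
  by move=> ->; rewrite opprK.
have XY : pauliX C *m pauliY C = - (pauliY C *m pauliX C).
  apply/matrixP => -[[|[|]] //= ?] [[|[|]] //= ?];
  by rewrite !mxE !big_ord_recl !big_ord0 !mxE /=
    ?(mulr0, mul0r, mulr1, mul1r, addr0, add0r, mulrN, mulNr, opprK, oppr0).
have XZ : pauliX C *m pauliZ C = - (pauliZ C *m pauliX C).
  apply/matrixP => -[[|[|]] //= ?] [[|[|]] //= ?];
  by rewrite !mxE !big_ord_recl !big_ord0 !mxE /=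
    ?(mulr0, mul0r, mulr1, mul1r, addr0, add0r, mulrN, mulNr, opprK, oppr0).
have YZ : pauliY C *m pauliZ C = - (pauliZ C *m pauliY C).
  apply/matrixP => -[[|[|]] //= ?] [[|[|]] //= ?];
  by rewrite !mxE !big_ord_recl !big_ord0 !mxE /=
    ?(mulr0, mul0r, mulr1, mul1r, addr0, add0r, mulrN, mulNr, opprK, oppr0).
rewrite !inE => /or4P[] /eqP -> /or4P[] /eqP ->;
  by [constructor 1|constructor 2|constructor 3|constructor 4|constructor 4; apply: anti].
Qed.

Lemma pauli_monomial (h : 'M[C]_2) : h \in paulis ->
  (forall a, h (bit a) (bit (~~ a)) = 0) \/ (forall a, h (bit a) (bit a) = 0).
Proof.
by rewrite !inE => /or4P[] /eqP ->; [left|right|right|left] => -[]; rewrite !mxE.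
Qed.

(** In [E a b c d] the bits [a], [b] are the outputs and [c], [d] the inputs; the condition is
    operator Schmidt rank at most 2. *)
Definition separable (E : bool -> bool -> bool -> bool -> C) :=
  exists U V : bool -> bool -> bool -> C,
  forall a b c d, E a b c d = \sum_s U s a c * V s b d.

(** This is the case where X on the first input becomes the operator [G] on the first output. The
    block with [c] true is [G] applied to the block with [c] false, so summing over the first output
    bit of the latter gives two terms. *)
Lemma separable_flip (E : bool -> bool -> bool -> bool -> C) (G : bool -> bool -> C) :
  (forall a b d, E a b true d = \sum_s G a s * E s b false d) -> separable E.
Proof.
move=> h; exists (fun s a c => if c then G a s else (a == s)%:R).
exists (fun s b d => E s b false d) => a b [] d; first exact: h.
rewrite (bigD1 a) //= eqxx mul1r big1 ?addr0 // => s sa.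
by rewrite eq_sym (negPf sa) mul0r.
Qed.

(** This is the case where Z on the first input becomes [G] on the first output. A diagonal [G]
    makes [c] a function of [a] wherever [E] is nonzero; an antidiagonal one determines the block
    with [a] false from the block with [a] true. *)
Lemma separable_phase (E : bool -> bool -> bool -> bool -> C) (G : bool -> bool -> C) :
  (forall a, G a (~~ a) = 0) \/ (forall a, G a a = 0) ->
  (forall a b (c : bool) d, (-1) ^+ c * E a b c d = \sum_s G a s * E s b c d) ->
  separable E.
Proof.
case=> G0 h.
  have {}h a b (c : bool) d : (-1) ^+ c * E a b c d = G a a * E a b c d.
    by rewrite h big_bool; case: a (G0 a) => /= ->; rewrite mul0r ?addr0 ?add0r.
  (* [o a] is the only value of [c] for which [E a b c d] can be nonzero: any other forces a sign
     different from [G a a]. *)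
  pose o a := G a a != 1.
  exists (fun s a c => ((a == s) && (c == o a))%:R), (fun s b d => E s b (o s) d).
  move=> a b c d; rewrite (bigD1 a) //= eqxx big1 ?addr0; last first.
    by move=> s sa; rewrite eq_sym (negPf sa) mul0r.
  case: eqP => [->|/eqP co]; first by rewrite mul1r.
  rewrite mul0r; apply/eqP; have := h a b c d; move/eqP.
  rewrite -subr_eq0 -mulrBl mulf_eq0 => /orP[|//]; rewrite subr_eq0 => /eqP.
  have -> : c = (G a a == 1) by move: co; rewrite /o; case: c (G a a == 1) => -[].
  case: eqP => [->|ne]; last by rewrite expr0 => /esym.
  move/eqP; rewrite expr1 eq_sym.
  by rewrite -subr_eq0 opprK -mulr2n pnatr_eq0.
exists (fun s a c => ((c : bool) == s)%:R * (if a then 1 else (-1) ^+ c * G false true)).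
exists (fun s b d => E true b s d) => a b c d.
rewrite (bigD1 c) //= eqxx mul1r big1 ?addr0; last first.
  by move=> s sa; rewrite eq_sym (negPf sa) !mul0r.
case: a; first by rewrite mul1r.
have := h false b c d; rewrite big_bool /= G0 mul0r addr0 => e.
by rewrite -mulrA -e mulrA -expr2 sqrr_sign mul1r.
Qed.

Definition coef2 (U : operator 2) a b c d := entry U (bits2 a b) (bits2 c d).

Lemma entry_id2 a b : (1%:M : 'M[C]_2) (bit a) (bit b) = (a == b)%:R.
Proof. by case: a b => -[]; rewrite mxE. Qed.

Lemma entryZ n x (U : operator n) a b : entry (x *: U) a b = x * entry U a b.
Proof. by rewrite /entry mxE. Qed.

Lemma coef2_mulr (U : operator 2) h a b c d :
  coef2 (U *m tensor (pair2 h 1%:M)) a b c d =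
  \sum_s coef2 U a b s d * h (bit s) (bit c).
Proof.
rewrite /coef2 Preparation.ent_mul sum_bits2; apply: eq_bigr => s _.
rewrite (bigD1 d) //= big1 => [|d' dd]; rewrite entry_pair2 entry_id2.
  by rewrite eqxx mulr1 addr0.
by rewrite (negPf dd) !mulr0.
Qed.

Lemma coef2_mull (U : operator 2) x h a b c d :
  coef2 (x *: tensor (pair2 h 1%:M) *m U) a b c d =
  \sum_s x * h (bit a) (bit s) * coef2 U s b c d.
Proof.
rewrite /coef2 Preparation.ent_mul sum_bits2; apply: eq_bigr => s _.
rewrite (bigD1 b) //= big1 => [|b' bb]; rewrite entryZ entry_pair2 entry_id2.
  by rewrite eqxx mulr1 addr0.
by rewrite eq_sym (negPf bb) !mulr0 mul0r.
Qed.

Lemma coef2_mull' (U : operator 2) x h a b c d :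
  coef2 (x *: tensor (pair2 1%:M h) *m U) a b c d =
  \sum_s x * h (bit b) (bit s) * coef2 U a s c d.
Proof.
rewrite /coef2 Preparation.ent_mul sum_bits2 exchange_big; apply: eq_bigr => s _.
rewrite (bigD1 a) //= big1 => [|a' aa]; rewrite entryZ entry_pair2 entry_id2.
  by rewrite eqxx mul1r addr0.
by rewrite eq_sym (negPf aa) mul0r mulr0 mul0r.
Qed.

Lemma clifford_conj n (U : operator n) P : clifford U -> pauli_group P ->
  exists2 Q, pauli_group Q & U *m P = Q *m U.
Proof.
case=> uU cU pP; exists (U *m P *m U ^t*).
  by rewrite -cU; exists P.
have u1 : U ^t* *m U = 1%:M by apply: mulmx1C; apply/unitarymxP.
by rewrite -!mulmxA u1 mulmx1.
Qed.

(* One of X, Z and XZ on the first qubit is conjugated to a multiple of an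
   operator acting on a single qubit; intertwining it with U makes U separable,
   across the second partition if that qubit is the second one. *)
Lemma clifford2_separable (U : operator 2) : clifford U ->
  separable (coef2 U) \/ separable (fun a b => coef2 U b a).
Proof.
move=> cU.
have pP h : h \in paulis -> pauli_group (tensor (pair2 h 1%:M)).
  move=> hp; exists 1, (pair2 h 1%:M); split; rewrite ?inE ?eqxx ?scale1r //.
  by move=> j; rewrite /pair2; case: ifP; rewrite // inE eqxx.
have [|P [a [h [_ hp ->]]] eX] := clifford_conj cU (pP (pauliX C) _).
  by rewrite !inE eqxx orbT.
have [|Q [b [k [_ kp ->]]] eZ] := clifford_conj cU (pP (pauliZ C) _).
  by rewrite !inE eqxx !orbT.
rewrite (tensor_pair2 h) in eX; rewrite (tensor_pair2 k) in eZ.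
set h0 := h ord0 in eX; set h1 := h ord_max in eX.
set k0 := k ord0 in eZ; set k1 := k ord_max in eZ.
have mulZZ x y (A B : operator 2) : (x *: A) *m (y *: B) = (x * y) *: (A *m B).
  by rewrite -scalemxAl -scalemxAr scalerA.
have eXZ : U *m tensor (pair2 (pauliX C *m pauliZ C) 1%:M) =
    (a * b) *: tensor (pair2 (h0 *m k0) (h1 *m k1)) *m U.
  rewrite -{1}[1%:M]mulmx1 -tensor_pair2_mul mulmxA eX -mulmxA eZ mulmxA.
  by rewrite mulZZ tensor_pair2_mul.
have eZX : U *m tensor (pair2 (pauliZ C *m pauliX C) 1%:M) =
    (a * b) *: tensor (pair2 (k0 *m h0) (k1 *m h1)) *m U.
  rewrite -{1}[1%:M]mulmx1 -tensor_pair2_mul mulmxA eZ -mulmxA eX mulmxA.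
  by rewrite mulZZ tensor_pair2_mul mulrC.
have colX E x c : \sum_s coef2 U E x s c * pauliX C (bit s) (bit false) =
    coef2 U E x true c.
  by rewrite big_bool !mxE /= mulr1 mulr0 addr0.
have colXZ E x c : \sum_s coef2 U E x s c * (pauliX C *m pauliZ C) (bit s) (bit false)
    = coef2 U E x true c.
  rewrite big_bool !mxE !big_ord_recl !big_ord0 !mxE /=.
  by rewrite !(mulr0, mulr1, addr0, add0r, mul0r).
have colZ E x s c : \sum_t coef2 U E x t c * pauliZ C (bit t) (bit s) =
    (-1) ^+ s * coef2 U E x s c.
  rewrite big_bool !mxE /=; case: s; rewrite /= ?expr0 ?expr1.
    by rewrite mulr0 addr0 mulrC.
  by rewrite mulr0 add0r mulrC.
(* In the first three cases the image of X, Z or XZ, respectively, is trivial on the second qubit;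
   otherwise the same analysis is made on the first qubit. *)
case: (pauli_anticommute (hp ord_max) (kp ord_max)) => [h1E|k1E|hkE|anti1].
- left; apply: (@separable_flip _ (fun x s => a * h0 (bit x) (bit s))) => x y z.
  by rewrite -colX -coef2_mulr eX /h1 h1E coef2_mull.
- left; apply: (@separable_phase _ (fun x s => b * k0 (bit x) (bit s))) => [|x y s z].
    by case: (pauli_monomial (kp ord0)) => m0; [left|right] => s; rewrite m0 mulr0.
  by rewrite -colZ -coef2_mulr eZ /k1 k1E coef2_mull.
- left; apply: (@separable_flip _ (fun x s => a * b * (h0 *m k0) (bit x) (bit s)))
    => x y z.
  by rewrite -colXZ -coef2_mulr eXZ /h1 hkE pauli_sq // coef2_mull.
case: (pauli_anticommute (hp ord0) (kp ord0)) => [h0E|k0E|hkE|anti0].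
- right; apply: (@separable_flip _ (fun x s => a * h1 (bit x) (bit s))) => x y z.
  by rewrite -colX -coef2_mulr eX /h0 h0E coef2_mull'.
- right; apply: (@separable_phase _ (fun x s => b * k1 (bit x) (bit s))) => [|x y s z].
    by case: (pauli_monomial (kp ord_max)) => m0; [left|right] => s; rewrite m0 mulr0.
  by rewrite -colZ -coef2_mulr eZ /k0 k0E coef2_mull'.
- right; apply: (@separable_flip _ (fun x s => a * b * (h1 *m k1) (bit x) (bit s)))
    => x y z.
  by rewrite -colXZ -coef2_mulr eXZ /h0 hkE pauli_sq // coef2_mull'.
(* If the images anticommute on both qubits, the two signs cancel and the images commute, although X
   and Z do not. *)
exfalso; move: eXZ; rewrite /h0 /h1 /k0 /k1 anti0 anti1 !tensor_pair2N opprK -eZX.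
have uU : U ^t* *m U = 1%:M by apply: mulmx1C; apply/unitarymxP; case: cU.
move/(congr1 (mulmx (U ^t*))); rewrite !mulmxA uU !mul1mx.
move/(congr1 (fun M => entry M (bits2 false false) (bits2 true false))).
rewrite !entry_pair2 !mxE !big_ord_recl !big_ord0 !mxE /=.
rewrite !(mulr0, mulr1, addr0, add0r, mul0r, mul1r) => /eqP.
by rewrite eq_sym -subr_eq0 opprK -mulr2n pnatr_eq0.
Qed.

End Clifford.

(** * Algorithms *)

Section Algorithm.
Import GRing.Theory Num.Theory.
Local Open Scope ring_scope.
Variable C : numClosedFieldType.
Local Notation bits n := {ffun 'I_n -> bool}.
Local Notation state n := 'cV[C]_#|{ffun 'I_n -> bool}|.
Local Notation operator n := 'M[C]_#|{ffun 'I_n -> bool}|.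
Local Notation upd := Preparation.upd.

Lemma amplitude_act k m (t : k.-tuple 'I_m) (U : operator k) (psi : state m) x :
  amplitude (act_on t U *m psi) x =
  \sum_(y : bits m | [forall q, (q \notin t) ==> (x q == y q)])
    entry U [ffun i => x (tnth t i)] [ffun i => y (tnth t i)] * amplitude psi y.
Proof.
rewrite Preparation.amp_mul [RHS]big_mkcond; apply: eq_bigr => y _.
by rewrite Preparation.ent_oper; case: ifP => _ //; rewrite mul0r.
Qed.

Lemma amplitude_act1 m (q : 'I_m) (U : operator 1) (psi : state m) :
  amplitude (act_on [tuple q] U *m psi) =
  gate1 (fun a b => entry U (Preparation.b1 a) (Preparation.b1 b)) q (amplitude psi).
Proof.
apply/funext => x; rewrite amplitude_act.
rewrite (reindex_onto (upd x q) (fun y : bits m => y q)) => [|y /forallP h]; last first.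
  apply/ffunP => j; rewrite ffunE; case: eqP => [->//|/eqP jq].
  by have := h j; rewrite inE jq => /eqP.
apply: eq_big => [b|b _].
  apply/andP; split; last by rewrite ffunE !eqxx.
  apply/forallP => j; apply/implyP; rewrite inE => jq.
  by rewrite ffunE (negPf jq).
congr (entry U _ _ * _); apply/ffunP => i; rewrite !ffunE (tnth_nth q) ord1 //=.
by rewrite eqxx.
Qed.

Lemma amplitude_act2 m (p q : 'I_m) (U : operator 2) (psi : state m) : p != q ->
  amplitude (act_on [tuple p; q] U *m psi) = fun x =>
  \sum_b \sum_b' coef2 U (x p) (x q) b b' * amplitude psi (upd (upd x p b) q b').
Proof.
move=> pq; apply/funext => x; rewrite amplitude_act pair_bigA.
rewrite (reindex_onto (fun b => upd (upd x p b.1) q b.2)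
  (fun y : bits m => (y p, y q))) => [|y /forallP h]; last first.
  apply/ffunP => j; rewrite !ffunE /=; case: eqP => [->//|/eqP jq].
  case: eqP => [->//|/eqP jp].
  by have := h j; rewrite !inE negb_or jq jp => /eqP.
apply: eq_big => [[b b']|[b b'] _] /=.
  apply/andP; split; last by rewrite !ffunE (negPf pq) !eqxx.
  apply/forallP => j; apply/implyP.
  by rewrite !inE negb_or !ffunE => /andP[/negPf -> /negPf ->].
by congr (entry U _ _ * _); apply/ffunP => i; rewrite !ffunE (tnth_nth q);
  case: i => -[|[|]] //= _; rewrite ?eqxx ?(negPf pq).
Qed.

Lemma gate2E m (p q : 'I_m) U V (E : bool -> bool -> bool -> bool -> C) (x : bits m) phi :
    p != q -> (forall a b c d, E a b c d = \sum_s U s a c * V s b d) ->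
  gate2 U V p q phi x =
  \sum_b \sum_b' E (x p) (x q) b b' * phi (upd (upd x p b) q b').
Proof.
move=> pq EE; rewrite /gate2 /gate1 exchange_big; apply: eq_bigr => b _.
under [RHS]eq_bigr => b' _ do rewrite EE mulr_suml.
rewrite exchange_big; apply: eq_bigr => s _; rewrite mulr_sumr.
by apply: eq_bigr => b' _; rewrite ffunE eq_sym (negPf pq) mulrA.
Qed.

Lemma factored_leq m (psi : bits m -> C) k k' : (k <= k')%N ->
  factored psi k -> factored psi k'.
Proof.
move=> kk' [L [c [phi [kk [e ks h]]]]]; exists L, c, phi, kk; split=> //.
exact: leq_trans ks kk'.
Qed.

(** In the second case the gate is a separable operator followed by the exchange of [p] and [q],
    which is a pullback along a transposition and costs nothing. *)
Lemma factored_clifford2 m (p q : 'I_m) (U : operator 2) (psi : state m) k :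
  p != q -> clifford U -> factored (amplitude psi) k ->
  factored (amplitude (act_on [tuple p; q] U *m psi)) k.+1.
Proof.
move=> pq /clifford2_separable[[V [W E]]|[V [W E]]] fpsi; rewrite amplitude_act2 //.
  have := factored_gate2 V W p q fpsi; congr (factored _ _).
  by apply/funext => x; rewrite (gate2E _ _ pq E).
pose e (x : bits m) : bits m := [ffun j => x (tperm p q j)].
have -> : (fun x : bits m => \sum_b \sum_b' coef2 U (x p) (x q) b b' *
    amplitude psi (upd (upd x p b) q b')) =
  fun x => gate2 V W p q (amplitude psi) (e x).
  apply/funext => x.
  rewrite (gate2E (E := fun a b => coef2 U b a) _ _ pq E).
  apply: eq_bigr => b _; apply: eq_bigr => b' _.
  rewrite !ffunE tpermL tpermR; congr (_ * amplitude psi _).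
  apply/ffunP => j; rewrite !ffunE; case: eqP => // /eqP jq; case: eqP => // /eqP jp.
  by rewrite tpermD // eq_sym.
apply: (factored_pull (h := tperm p q)) (factored_gate2 V W p q fpsi).
- exact: perm_inj.
- by move=> x j; rewrite ffunE tpermK.
- by move=> x y j /codomP[]; exists (tperm p q j); rewrite tpermK.
Qed.

Lemma factored_collapse m (q : 'I_m.+1) b (psi : state m.+1) k :
  factored (amplitude psi) k -> factored (amplitude (collapse q b psi)) k.
Proof.
pose e (x : bits m) : bits m.+1 := [ffun j => if unlift q j is Some i then x i else b].
move=> fpsi.
have -> : amplitude (collapse q b psi) = fun x => amplitude psi (e x).
  by apply/funext => x; rewrite Preparation.amp_ket.
apply: (factored_pull (h := lift q)) fpsi.
- exact: lift_inj.
- by move=> x j; rewrite ffunE liftK.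
- move=> x y j; rewrite !ffunE; case: unliftP => // i ->.
  by rewrite codom_f.
Qed.

(** The states are unnormalised, so a branch is followed as long as its weight is nonzero; the total
    weight is the sum over the outcomes. *)
Lemma factored_success n (good : pred (state n)) m (A : algorithm C n m) :
  forall (psi : state m) k, factored (amplitude psi) k -> success good A psi != 0 ->
  exists2 phi, good phi & factored (amplitude phi) (k + cz_complexity A).
Proof.
elim: A => [|m' q next IH|m' q U cU A IH|m' p q pq U cU A IH] psi k fpsi /=.
- by case: ifP => [gpsi _|]; rewrite ?eqxx // addn0; exists psi.
- set s := success _ (next false) _ => st.
  have [b sb] : exists b, success good (next b) (collapse q b psi) != 0.
    have [s0|s0] := eqVneq s 0; last by exists false.
    by exists true; rewrite s0 add0r in st.
  have [phi gphi fphi] := IH b _ _ (factored_collapse q b fpsi) sb.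
  exists phi => //; apply: factored_leq fphi; rewrite leq_add2l.
  by case: (b); rewrite leq_max leqnn ?orbT.
- by apply: IH; rewrite amplitude_act1; apply: factored_gate1.
- by rewrite addnS -addSn; apply: IH; apply: factored_clifford2.
Qed.

End Algorithm.

(** * Cut-rank of graph states *)

Section GraphStateCuts.
Import GRing.Theory Num.Theory.
Local Open Scope ring_scope.
Variable C : numClosedFieldType.
Local Notation bits n := {ffun 'I_n -> bool}.
Local Notation state n := 'cV[C]_#|{ffun 'I_n -> bool}|.

(** * Character sums over a finite field *)

Section Characters.
Variables (F : finFieldType) (chi : F -> C).
Hypothesis chiD : forall a b, chi (a + b) = chi a * chi b.
Hypothesis chi0 : chi 0 = 1.
Hypothesis chi_neq1 : exists a, chi a != 1.

(** Orthogonality of characters: for nonzero [x], a translation of [y] by a vector whose product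
    with [x] is [a] multiplies the sum by [chi a], which differs from 1. *)
Lemma sum_character r (x : 'rV[F]_r) :
  \sum_(y : 'rV[F]_r) chi ((x *m y^T) 0 0) = if x == 0 then (#|F| ^ r)%:R else 0.
Proof.
have [->|x0] := eqVneq x 0.
  under eq_bigr do rewrite mul0mx mxE chi0.
  by rewrite sumr_const card_mx mul1n.
have [i xi] : exists i, x 0 i != 0.
  apply/existsP; apply: contraR x0; rewrite negb_exists => /forallP h.
  by apply/eqP/rowP => i; rewrite mxE; apply/eqP; have := h i; rewrite negbK.
have [a a1] := chi_neq1; pose v : 'rV[F]_r := (a / x 0 i) *: delta_mx 0 i.
set s := \sum_y _; have : s = s * chi a.
  rewrite {1}/s (reindex_inj (addIr v)) /= mulr_suml.
  apply: eq_bigr => y _; rewrite linearD mulmxDr mxE chiD; congr (_ * chi _).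
  rewrite linearZ /= trmx_delta -scalemxAr -colE !mxE.
  by rewrite -mulrA mulVf // mulr1.
move/eqP; rewrite -subr_eq0 -{1}[s]mulr1 -mulrBr mulf_eq0 => /orP[/eqP //|].
by rewrite subr_eq0 eq_sym (negPf a1).
Qed.

(** The character table is invertible and stays so after scaling rows and columns by nonzero
    factors, so it cannot factor through fewer than #|F|^r terms. *)
Lemma card_character_factor r (I : finType) (f g : 'rV[F]_r -> I -> C)
    (s t : 'rV[F]_r -> C) :
    (forall x, s x != 0) -> (forall y, t y != 0) ->
    (forall x y, \sum_i f x i * g y i = s x * t y * chi ((x *m y^T) 0 0)) ->
  (#|F| ^ r <= #|I|)%N.
Proof.
move=> s0 t0 fg; have card_rV : #|{: 'rV[F]_r}| = (#|F| ^ r)%N by rewrite card_mx mul1n.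
have p0 : (#|F| ^ r)%:R != 0 :> C.
  rewrite pnatr_eq0 expn_eq0 negb_and -lt0n.
  by apply/orP; left; apply/card_gt0P; exists 0.
pose A := \matrix_(x < #|{: 'rV[F]_r}|, i < #|I|) f (enum_val x) (enum_val i).
pose B := \matrix_(i < #|I|, y < #|{: 'rV[F]_r}|) g (enum_val y) (enum_val i).
(* The inverse given by orthogonality, with the factors [s] and [t] divided out. *)
pose D := \matrix_(y < #|{: 'rV[F]_r}|, z < #|{: 'rV[F]_r}|)
  (chi ((- enum_val z *m (enum_val y)^T) 0 0) /
    (t (enum_val y) * s (enum_val z) * (#|F| ^ r)%:R)).
suff ABD : A *m B *m D = 1%:M.
  rewrite -card_rV; have /eqP <- : row_free A; last exact: rank_leq_col.
  by apply/row_freeP; exists (B *m D); rewrite mulmxA.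
apply/matrixP => i k; rewrite mxE [RHS]mxE.
pose x : 'rV[F]_r := enum_val i; pose z : 'rV[F]_r := enum_val k.
have -> : (i == k) = (x == z) by rewrite (inj_eq enum_val_inj).
transitivity (s x / s z / (#|F| ^ r)%:R *
    \sum_(y : 'rV[F]_r) chi (((x - z) *m y^T) 0 0)).
  rewrite mulr_sumr (reindex (fun j : 'I_#|{: 'rV[F]_r}| => enum_val j)) /=; last first.
    by apply: onW_bij; apply: enum_val_bij.
  apply: eq_bigr => j _; rewrite [(A *m B) i j]mxE [D j k]mxE.
  have -> : \sum_a A i a * B a j = \sum_a f x a * g (enum_val j) a.
    rewrite [RHS](reindex (fun a : 'I_#|I| => enum_val a)) /=; last first.
      by apply: onW_bij; apply: enum_val_bij.
    by apply: eq_bigr => a _; rewrite !mxE.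
  rewrite fg mulmxDl [((x *m _) + _) _ _]mxE chiD.
  move: (t0 (enum_val j)) (s0 z) p0; rewrite -/z => tn sn pn.
  by field; rewrite tn sn pn.
rewrite sum_character subr_eq0; case: eqP => [->|_]; last by rewrite mulr0.
by rewrite divff // mul1r mulVf.
Qed.

End Characters.

Lemma mulmx_entry (R : nzRingType) m k (x : 'rV[R]_m) (M : 'M_(m, k)) (y : 'cV_k) :
  (x *m M *m y) 0 0 = \sum_i \sum_j x 0 i * M i j * y j 0.
Proof.
rewrite mxE exchange_big; apply: eq_bigr => j _.
by rewrite mxE mulr_suml.
Qed.

Definition sign2 (z : 'F_2) : C := if z == 0 then 1 else -1.

Lemma F2_cases (z : 'F_2) : z = 0 \/ z = 1.
Proof. by case: z => -[|[|]] // i; [left|right]; apply: val_inj. Qed.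

Lemma sign2D x y : sign2 (x + y) = sign2 x * sign2 y.
Proof.
case: (F2_cases x) (F2_cases y) => -> [] ->; rewrite /sign2 /= ?mulr1 ?mul1r //.
by rewrite mulrNN mulr1.
Qed.

Lemma sign2_sum (I : finType) (F : I -> 'F_2) :
  sign2 (\sum_i F i) = \prod_i sign2 (F i).
Proof. exact: (big_morph sign2 sign2D). Qed.

(** * Amplitudes of a graph state and its cuts *)

Section Fixed.
Variables (n : nat) (G : sgraph 'I_n) (psi : state n).
Hypothesis Gpsi : is_graph_state G psi.
Implicit Types (X Y S : {set 'I_n}) (v : 'I_n).

Definition indic (X : {set 'I_n}) : bits n := [ffun j => j \in X].
Local Notation amp X := (amplitude psi (indic X)).
Definition chi (v : 'I_n) (Y : {set 'I_n}) : C := \prod_(w | G v w) (-1) ^+ (w \in Y).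

Lemma chi_neq0 v Y : chi v Y != 0.
Proof. by rewrite prodf_seq_neq0; apply/allP => w _; rewrite signr_eq0 implybT. Qed.

(** The stabilizer at [v] flips bit [v], and its sign ignores that bit because [v] is not its own
    neighbour. *)
Lemma amp_setU1 v X : v \notin X -> amp (v |: X) = chi v X * amp X.
Proof.
move=> vX; have /andP[_ /forallP/(_ v)/eqP e] := Gpsi.
rewrite -{1}e Preparation.tensor_amp; congr (_ * amplitude psi _).
  apply: eq_bigr => w Gvw; rewrite ffunE !inE; case: eqP => // wv.
  by rewrite wv adj_irr in Gvw.
apply/ffunP => w; rewrite !ffunE !inE eqxx /=; case: eqP => // ->.
by rewrite (negPf vX).
Qed.

Lemma set_card_ind (P : {set 'I_n} -> Prop) : P set0 ->
  (forall v X, v \notin X -> P X -> P (v |: X)) -> forall X, P X.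
Proof.
move=> P0 IH X; have [k] := ubnP #|X|; elim: k X => // k IHk X.
have [->//|[v vX]] := set_0Vmem X.
rewrite (cardsD1 v) vX ltnS add1n => Xk.
by rewrite -(setD1K vX); apply: IH; [rewrite !inE eqxx|apply: IHk].
Qed.

(** Every amplitude is a multiple of this one, so its vanishing would make the whole state zero. *)
Lemma amp_set0_neq0 : amp set0 != 0.
Proof.
have /andP[+ _] := Gpsi; apply: contraNneq => a0.
have aX X : amp X = 0.
  move: X; apply: set_card_ind => // v X vX e.
  by rewrite amp_setU1 // e mulr0.
apply/eqP/Preparation.amp_ext => x; rewrite [RHS]mxE.
rewrite -[RHS](aX [set j | x j]); congr amplitude.
by apply/ffunP => j; rewrite ffunE inE.
Qed.

Lemma amp_neq0 X : amp X != 0.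
Proof.
move: X; apply: set_card_ind => [|v X vX e]; first exact: amp_set0_neq0.
by rewrite amp_setU1 // mulf_neq0 // chi_neq0.
Qed.

(** The product on the right is -1 to the number of edges between [X] and [Y]; the factor [amp set0]
    compensates for the missing normalisation. *)
Lemma amp_setU X Y : [disjoint X & Y] ->
  amp (X :|: Y) * amp set0 = amp X * amp Y * \prod_(v in X) chi v Y.
Proof.
move: X; apply: set_card_ind => [_|v X vX IH dXY].
  by rewrite set0U big_set0 mulr1 mulrC.
have vY : v \notin Y by rewrite (disjointFr dXY) // !inE eqxx.
have {}dXY : [disjoint X & Y] by apply: disjointWl dXY; apply: subsetUr.
rewrite -setUA !amp_setU1 ?inE ?negb_or ?vX // big_setU1 //= -mulrA IH //.
have -> : chi v (X :|: Y) = chi v X * chi v Y.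
  rewrite -big_split; apply: eq_bigr => w _; rewrite inE.
  have [wX|_] := boolP (w \in X); last by rewrite /= expr0 mul1r.
  by rewrite (disjointFr dXY wX) /= expr0 mulr1.
by ring.
Qed.

(* On suitably chosen rows and columns, the amplitude matrix across the cut is
   the character table of F_2^r, up to nonzero row and column factors. *)
Lemma schmidt_cutrank S w : schmidt_le (amplitude psi) S (~: S) w ->
  (cutrank G S <= w)%N.
Proof.
case=> I [f [g [cI df dg e]]]; rewrite /cutrank; set M := \matrix_(_, _) _.
(* [F] forms a basis of the row space of [M], and [N] is a right inverse of that basis, so that
   [F *m M *m N] is the identity. *)
have [F FM] : exists F, row_base M = F *m M.
  by apply/submxP; rewrite eq_row_base.
have /row_freeP[N MN] := row_base_free M.
rewrite FM in MN; set r := \rank M in F FM N MN *.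
(* Taking supports of [x *m F] and [N *m y^T] makes the parity of the number of edges between [X x]
   and [Y y] equal to [x *m y^T]. *)
pose X (x : 'rV['F_2]_r) := [set enum_val i | i : 'I_#|S| & (x *m F) 0 i != 0]%SET.
pose Y (y : 'rV['F_2]_r) := [set enum_val j | j : 'I_#|~: S| & (N *m y^T) j 0 != 0]%SET.
have XS x : X x \subset S by apply/subsetP => _ /imsetP[i _ ->]; apply: enum_valP.
have YS y : Y y \subset ~: S by apply/subsetP => _ /imsetP[i _ ->]; apply: enum_valP.
have dXY x y : [disjoint X x & Y y].
  by apply: disjointWl (XS x) _; rewrite disjoint_sym disjoints_subset.
rewrite -(leq_exp2l _ _ (ltnSn 1)); apply: leq_trans cI.
have s1 : exists a, sign2 a != 1.
  by exists 1; rewrite /sign2 /= -subr_eq0 -opprD oppr_eq0 -mulr2n pnatr_eq0.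
have s0 : sign2 0 = 1 by rewrite /sign2 eqxx.
rewrite -[X in (X ^ _)%N](card_Fp (isT : prime 2)).
apply: (@card_character_factor _ _ sign2D s0 s1 _ _ (fun x i => f i (indic (X x)))
  (fun y i => g i (indic (Y y))) (fun x => amp (X x)) (fun y => amp (Y y) / amp set0)).
- by move=> x; apply: amp_neq0.
- by move=> y; rewrite mulf_neq0 ?invr_eq0 ?amp_neq0.
move=> x y; transitivity (amp (X x :|: Y y)).
  rewrite e; apply: eq_bigr => i _; congr (_ * _).
    apply: df => v vS; rewrite !ffunE inE.
    have : v \notin Y y by apply: contraL vS => /(subsetP (YS y)); rewrite inE.
    by move=> /negPf ->; rewrite orbF.
  apply: dg => v vS; rewrite !ffunE inE.
  have : v \notin X x by move: vS; rewrite inE; apply: contra => /(subsetP (XS x)).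
  by move=> /negPf ->.
apply: (mulIf (amp_neq0 set0)); rewrite amp_setU //.
have cancel (a b c d : C) : c != 0 -> a * (b / c) * d * c = a * b * d.
  by move=> c0; field.
rewrite cancel ?amp_neq0 //; congr (_ * _).
have -> : x *m y^T = (x *m F) *m M *m (N *m y^T).
  by rewrite -[x *m F *m M]mulmxA -mulmxA [F *m M *m _]mulmxA MN mul1mx.
rewrite mulmx_entry sign2_sum big_imset /=; last by move=> ? ? _ _; apply: enum_val_inj.
rewrite [LHS]big_mkcond; apply: eq_bigr => i _; rewrite sign2_sum inE.
case: (F2_cases ((x *m F) 0 i)) => ->.
  by rewrite eqxx big1 // => j _; rewrite !mul0r /sign2 eqxx.
rewrite oner_neq0.
transitivity (\prod_(w in Y y) (if G (enum_val i) w then -1 else 1 : C)).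
  rewrite /chi big_mkcond [RHS]big_mkcond; apply: eq_bigr => u _.
  by case: ifP => _; case: ifP => _; rewrite ?expr0 ?expr1.
rewrite big_imset /=; last by move=> ? ? _ _; apply: enum_val_inj.
rewrite big_mkcond; apply: eq_bigr => j _; rewrite inE mul1r.
case: (F2_cases ((N *m y^T) j 0)) => ->; first by rewrite eqxx mulr0 /sign2 eqxx.
rewrite oner_neq0 mulr1 /M; set b := G _ _.
have -> : (\matrix_(i, j) (G (enum_val i) (enum_val j))%:R
    : 'M['F_2]_(#|S|, #|~: S|)) i j = b%:R.
  by rewrite mxE.
by case: b.
Qed.

End Fixed.
End GraphStateCuts.

(** * From the factored state to the lower bound *)

Lemma connected_cutrank n (G : sgraph 'I_n) (S : {set 'I_n}) v :
  connected_graph G -> v \in S -> cutrank G S = 0 -> S = setT.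
Proof.
move=> Gc vS /eqP; rewrite mxrank_eq0 => /eqP M0; apply/setP => u; rewrite [RHS]inE.
suff cl : closed G (mem S) by rewrite -(closed_connect cl (Gc v u)).
apply: intro_closed; first exact: sym_connect_sym (@adj_sym _ G).
move=> x y Gxy xS; apply: contraTT Gxy => yS.
have yS' : y \in ~: S by rewrite inE.
move/matrixP/(_ (enum_rank_in xS x) (enum_rank_in yS' y)): M0.
by rewrite !mxE !enum_rankK_in //; case: (G x y).
Qed.

Lemma min_nat_leq (P : nat -> Prop) k : P k -> min_nat P <= k.
Proof.
rewrite /min_nat => Pk; case: pselect => // e.
by case: ex_minnP => m _; apply; apply/asboolP.
Qed.

Lemma min_natP (P : nat -> Prop) k : P k -> P (min_nat P).
Proof.
rewrite /min_nat => Pk; case: pselect => [e|[]]; last by exists k; apply/asboolP.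
by case: ex_minnP => m /asboolP.
Qed.

Lemma rank_width_factored (C : numClosedFieldType) n (G : sgraph 'I_n) psi k :
  1 < n -> connected_graph G -> is_graph_state (C := C) G psi ->
  factored (amplitude psi) k -> n + rank_width G <= k + 2.
Proof.
move=> n1 Gc Gpsi [L [c [phi [kk [e ks h]]]]].
pose v : 'I_n := Ordinal (ltnW n1); pose K := [set u | c u == c v].
have dR : depends (~: K) (fun x => \prod_(l | l != c v) phi l x)%R.
  apply: depends_prod => l lv; apply: depends_sub (proj1 (h l)).
  by apply/subsetP => u; rewrite !inE => /eqP ->.
have psiE : amplitude psi = (fun x => phi (c v) x * \prod_(l | l != c v) phi l x)%R.
  by rewrite e; apply/funext => x; rewrite (bigD1 (c v)).
have vK : v \in K by rewrite inE.
(* The state is a product across [K], so this cut has rank zero and no edge of [G] crosses it. *)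
have KT : K = setT.
  apply: (connected_cutrank Gc vK); apply/eqP; rewrite -leqn0.
  apply: (schmidt_cutrank Gpsi); rewrite psiE.
  by rewrite -[~: K]set0U; apply: schmidt_mulr => //; apply/schmidt_trivial/(proj1 (h _)).
have [_ hv] := h (c v); have [|w [w0 kw d]] := hv.
  by apply/set0Pn; exists v.
rewrite -/K KT in d kw dR.
(* The other groups are empty, so their factors form a scalar that no cut notices. *)
have {}d : dec (fun S => schmidt_le (amplitude psi) S (~: S) w) setT.
  apply: dec_sub d => S _; rewrite -setTD psiE => s.
  by rewrite -[_ :\: _]setU0; apply: schmidt_mulr; rewrite -?setCT.
have [||D hD] := dec_rank_decomposition _ _ d.
- by rewrite card_ord.
- by move=> S /schmidt_sym; rewrite setCK.
have rw : rank_width G <= w.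
  apply: leq_trans (min_nat_leq (k := width G D) _) _; first by exists D.
  by apply/bigmax_leqP => -[x y] /hD; apply: schmidt_cutrank.
move: kw; rewrite cardsT card_ord => kw.
apply: leq_trans (leq_trans kw _); first by rewrite leq_add2l.
by rewrite leq_add2r; apply: leq_trans ks; rewrite (bigD1 (c v)) //= leq_addr.
Qed.

Unset Implicit Arguments.

Theorem theorem7 (R : realType) (n r : nat) (G : sgraph 'I_n)
    (n_ge2 : 2 <= n) (G_conn : connected_graph G) (r_le : r <= rank_width G) :
  n + r - 2 <= Gamma_CZ R[i] G.
Proof.
(* Some algorithm exists, so [Gamma_CZ] is attained and is not the default value 0 of [min_nat]. *)
have [s0 [A0 gA0]] := Preparation.exists_algorithm R[i] G.
have [|s [A [gA kE]]] := @min_natP (fun k => exists s (A : algorithm R[i] n (n + s)),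
    generates G A /\ cz_complexity A = k) (cz_complexity A0); first by exists s0, A0.
have {}kE : cz_complexity A = Gamma_CZ R[i] G := kE.
rewrite leq_subLR [2 + _]addnC -kE.
have [|phi Gphi fphi] := factored_success (factored_ket0 R[i] (n + s)) (A := A)
  (good := is_graph_state G).
  by rewrite gA GRing.oner_neq0.
apply: leq_trans (rank_width_factored n_ge2 G_conn Gphi fphi).
by rewrite leq_add2l.
Qed.
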